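(* The map $\varphi_+=R_+\circ S_+$ is a symplectomorphism from $(\Sigma_+,\ \sum_{i=1}^3 dq_i\wedge dp_i)$ to $(N_+,\ dx_0\wedge dy_0-\sum_{i=1}^3dx_i\wedge dy_i)$. Moreover, let $(q(t),p(t))$ be a Kepler orbit with energy $H>0$, eccentricity $e>1$ and periapsis at $t=0$, with hyperbolic anomaly $\psi_h(t)$ and hyperbolic mean anomaly $M_h(t)$; write $S_+(q(t),p(t))=(r(t),s(t),\sqrt{2H})$, let $s_0(t)$ be the zeroth component of $s(t)$, and let $(x(t),y(t))=\varphi_+(q(t),p(t))$. Then $$x(t)=\cosh(-\psi_h(t)-s_0(t))\,r(0)+\sinh(-\psi_h(t)-s_0(t))\,s(0),$$ $$y(t)=\frac{\sinh(-\psi_h(t)-s_0(t))\,r(0)+\cosh(-\psi_h(t)-s_0(t))\,s(0)}{\sqrt{2H}},$$ and $-\psi_h(t)-s_0(t)=M_h(t)$; thus the geodesic motion is parametrized by the mean anomaly $M_h$.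
   Context: The Kepler Hamiltonian is $H(q,p)=\frac12|p|^2-|q|^{-1}$ on $\{(q,p)\in\mathbb R^3\times\mathbb R^3: q\ne0\}$; a Kepler orbit is a solution of $\dot q=p$, $\dot p=-q/|q|^3$. Let $\Sigma_+=\{(q,p): q\ne0,\ H(q,p)>0\}$. On $\mathbb R^{1,3}$ use $\langle x,y\rangle_{(1,3)}=x_0y_0-x_1y_1-x_2y_2-x_3y_3$; let $H_+^3=\{x\in\mathbb R^{1,3}:\langle x,x\rangle_{(1,3)}=1,\ x_0>0\}$, $T^*H_+^3=\{(x,y): x\in H_+^3,\ \langle x,y\rangle_{(1,3)}=0\}$, $T_1^*H_+^3=\{(x,y)\in T^*H_+^3: \langle y,y\rangle_{(1,3)}=-1\}$, and $N_+=\{(x,y)\in T^*H_+^3: y\neq0,\ x_0\neq1\}$, where the 2-form $dx_0\wedge dy_0-\sum_{i=1}^3 dx_i\wedge dy_i=d\langle x,dy\rangle_{(1,3)}$ on $N_+$ is the restriction from $\mathbb R^4\times\mathbb R^4$. Define $S_+:\Sigma_+\to T_1^*H_+^3\times\mathbb R_{>0}$ by $S_+(q,p)=[(r_0,\bar r),(s_0,\bar s),\sqrt{2H}]$, where $$r_0=|p|^2|q|-1,\quad \bar r=-\sqrt{2H}\,|q|\,p,\quad s_0=-\sqrt{2H}\,\langle q,p\rangle,\quad \bar s=-\Big(\frac{q}{|q|}-\langle q,p\rangle p\Big).$$ The map $R_+$ sends $(r,s,\sqrt{2H})$ (the last entry being the $\mathbb R_{>0}$-component) to $(x,y)$ given by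 $$\begin{pmatrix}x_0&\bar x\\ y_0&\bar y\end{pmatrix}=\begin{pmatrix}\cosh(s_0)&-\sinh(s_0)\\ -\frac{\sinh(s_0)}{\sqrt{2H}}&\frac{\cosh(s_0)}{\sqrt{2H}}\end{pmatrix}\begin{pmatrix}r_0&\bar r\\ s_0&\bar s\end{pmatrix}.$$ For a hyperbolic orbit with $|a|=\frac1{2H}$, eccentricity $e>1$ and periapsis at $t=0$, the hyperbolic anomaly $\psi_h(t)$ (continuous, $\psi_h(0)=0$) and hyperbolic mean anomaly $M_h(t)$ satisfy $|q|=|a|(e\cosh\psi_h-1)$ and $M_h=e\sinh\psi_h-\psi_h=|a|^{-3/2}t$. *)

(* Defs.v *)
From HB Require Import structures.
From mathcomp Require Import all_boot all_order all_algebra.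
From mathcomp Require Import all_classical all_reals all_analysis.
From mathcomp Require Import ring lra.

Set Implicit Arguments.
Unset Strict Implicit.
Unset Printing Implicit Defensive.

Import Order.TTheory GRing.Theory Num.Theory.
Import numFieldNormedType.Exports.

Local Open Scope classical_set_scope.
Local Open Scope ring_scope.

Definition sinh (R : realType) (t : R) : R := (expR t - expR (- t)) / 2.
Definition cosh (R : realType) (t : R) : R := (expR t + expR (- t)) / 2.

(* To be used with U open and V finite-dimensional. There, f is C^(k+1) iff it
   is differentiable and all its directional derivatives are C^k. *)
Fixpoint Ck (R : realType) (V W : normedModType R) (U : set V) (k : nat)
    (f : V -> W) : Prop :=
  match k with
  | 0%N => forall x, U x -> {for x, continuous f}
  | k'.+1 => (forall x, U x -> differentiable f x) /\
             (forall v : V, Ck U k' (fun x => 'D_v f x))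
  end.

Definition smooth_open (R : realType) (V W : normedModType R) (U : set V)
    (f : V -> W) : Prop :=
  forall k, Ck U k f.

(* Smooth maps on an arbitrary subset A, in particular on an embedded
   submanifold: they extend locally to smooth maps of the ambient space. *)
Definition smooth_on (R : realType) (V W : normedModType R) (A : set V)
    (f : V -> W) : Prop :=
  forall x, A x -> exists (U : set V) (g : V -> W),
    [/\ open U, U x, smooth_open U g & forall y, U y -> A y -> f y = g y].

Definition diffeomorphism (R : realType) (V W : normedModType R)
    (A : set V) (B : set W) (f : V -> W) : Prop :=
  [/\ set_bij A B f, smooth_on A f &
      exists g : W -> V, (forall x, A x -> g (f x) = x) /\ smooth_on B g].

(* The two-forms at hand have constant coefficients on the ambient vector
   space, so they are given as bilinear maps. Since A is open, its tangent
   spaces are all of V; 'd f z maps them into the tangent spaces of B. The last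
   clause is f^* omB = omA, with omB restricted to B. *)
Definition symplectomorphism (R : realType) (V W : normedModType R)
    (A : set V) (omA : V -> V -> R) (B : set W) (omB : W -> W -> R)
    (f : V -> W) : Prop :=
  [/\ open A, diffeomorphism A B f &
      forall z, A z -> forall u v : V, omB ('d f z u) ('d f z v) = omA u v].

Definition wedge (R : realType) (V : Type) (a b : V -> R) (u v : V) : R :=
  a u * b v - a v * b u.

(* The library's norm on 'rV[R]_n is the sup norm, hence the explicit Euclidean
   norm below. *)
Definition dot (R : realType) (u v : 'rV[R]_3) : R :=
  \sum_(i < 3) u 0 i * v 0 i.
Definition enorm (R : realType) (u : 'rV[R]_3) : R := Num.sqrt (dot u u).

(* lift ord0 i is the index i + 1: the spatial coordinates are x_1, x_2, x_3. *)
Definition mdot (R : realType) (x y : 'rV[R]_4) : R :=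
  x 0 0 * y 0 0 - \sum_(i < 3) x 0 (lift ord0 i) * y 0 (lift ord0 i).

Definition mvec (R : realType) (a : R) (v : 'rV[R]_3) : 'rV[R]_4 :=
  row_mx (a%:M : 'rV_1) v.

Definition energy (R : realType) (z : 'rV[R]_3 * 'rV[R]_3) : R :=
  dot z.2 z.2 / 2 - (enorm z.1)^-1.

Definition Sigma_plus (R : realType) : set ('rV[R]_3 * 'rV[R]_3) :=
  [set z | z.1 != 0 /\ 0 < energy z].

Definition omega_std (R : realType) (u v : 'rV[R]_3 * 'rV[R]_3) : R :=
  \sum_(i < 3) wedge (fun w : 'rV[R]_3 * 'rV[R]_3 => w.1 0 i)
                     (fun w => w.2 0 i) u v.

Definition H3 (R : realType) : set ('rV[R]_4) :=
  [set x | mdot x x = 1 /\ 0 < x 0 0].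

Definition TH3 (R : realType) : set ('rV[R]_4 * 'rV[R]_4) :=
  [set w | H3 w.1 /\ mdot w.1 w.2 = 0].

Definition T1H3 (R : realType) : set ('rV[R]_4 * 'rV[R]_4) :=
  [set w | TH3 w /\ mdot w.2 w.2 = -1].

Definition N_plus (R : realType) : set ('rV[R]_4 * 'rV[R]_4) :=
  [set w | [/\ TH3 w, w.2 != 0 & w.1 0 0 != 1]].

Definition omega_mink (R : realType) (u v : 'rV[R]_4 * 'rV[R]_4) : R :=
  wedge (fun w : 'rV[R]_4 * 'rV[R]_4 => w.1 0 0) (fun w => w.2 0 0) u v
  - \sum_(i < 3) wedge (fun w : 'rV[R]_4 * 'rV[R]_4 => w.1 0 (lift ord0 i))
                       (fun w => w.2 0 (lift ord0 i)) u v.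

Definition S_plus (R : realType) (z : 'rV[R]_3 * 'rV[R]_3) :
    ('rV[R]_4 * 'rV[R]_4) * R :=
  let q := z.1 in let p := z.2 in
  let k := Num.sqrt (2 * energy z) in
  let r := mvec (dot p p * enorm q - 1) (- (k * enorm q) *: p) in
  let s := mvec (- (k * dot q p)) (- ((enorm q)^-1 *: q - dot q p *: p)) in
  ((r, s), k).

Lemma mvec0 (R : realType) (a : R) (v : 'rV[R]_3) : mvec a v 0 0 = a.
Proof.
have -> : (0 : 'I_4) = @lshift 1 3 0 by exact/val_inj.
by rewrite [LHS]row_mxEl mxE eqxx.
Qed.

Lemma mvecS (R : realType) (a : R) (v : 'rV[R]_3) (i : 'I_3) :
  mvec a v 0 (lift ord0 i) = v 0 i.
Proof.
have -> : (lift ord0 i : 'I_4) = @rshift 1 3 i by exact/val_inj.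
by rewrite [LHS]row_mxEr.
Qed.

Lemma mdot_mvec (R : realType) (a b : R) (v w : 'rV[R]_3) :
  mdot (mvec a v) (mvec b w) = a * b - dot v w.
Proof.
rewrite /mdot !mvec0; congr (_ - _).
by apply: eq_bigr => i _; rewrite !mvecS.
Qed.

Lemma S_plus_T1H3 (R : realType) (z : 'rV[R]_3 * 'rV[R]_3) :
  Sigma_plus z -> T1H3 (S_plus z).1 /\ 0 < (S_plus z).2.
Proof.
case: z => q p [/= q0 Hgt0].
have dotC (u v : 'rV[R]_3) : dot u v = dot v u.
  by apply: eq_bigr => i _; rewrite mulrC.
have dotDl (u v w : 'rV[R]_3) : dot (u + v) w = dot u w + dot v w.
  by rewrite /dot -big_split; apply: eq_bigr => i _; rewrite mxE mulrDl.
have dotZl a (u w : 'rV[R]_3) : dot (a *: u) w = a * dot u w.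
  by rewrite /dot mulr_sumr; apply: eq_bigr => i _; rewrite mxE mulrA.
have dotNl (u w : 'rV[R]_3) : dot (- u) w = - dot u w.
  by rewrite -scaleN1r dotZl mulN1r.
have dotDr (u v w : 'rV[R]_3) : dot w (u + v) = dot w u + dot w v.
  by rewrite dotC dotDl !(dotC w).
have dotZr a (u w : 'rV[R]_3) : dot w (a *: u) = a * dot w u.
  by rewrite dotC dotZl (dotC w).
have dotNr (u w : 'rV[R]_3) : dot w (- u) = - dot w u.
  by rewrite dotC dotNl (dotC w).
have qq : 0 < dot q q.
  rewrite lt_neqAle sumr_ge0 ?andbT; last by move=> i _; rewrite -expr2 sqr_ge0.
  apply: contra_neq q0 => /esym /psumr_eq0P d0; apply/rowP => i; rewrite mxE.
  apply/eqP; rewrite -sqrf_eq0 expr2 d0// => j _.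
  by rewrite -expr2 sqr_ge0.
set n := enorm q; have n0 : 0 < n by rewrite sqrtr_gt0.
have nn : dot q q = n ^+ 2 by rewrite sqr_sqrtr// ltW.
set H := energy _ in Hgt0 *; set k := Num.sqrt (2 * H).
have k0 : 0 < k by rewrite sqrtr_gt0 mulr_gt0.
have kk : k ^+ 2 = dot p p - 2 / n.
  rewrite sqr_sqrtr ?mulr_ge0// ?ltW// /H /energy /= -/n; field; lra.
have pp : dot p p = k ^+ 2 + 2 / n by rewrite kk subrK.
rewrite /S_plus /= -/n -/H -/k; split => //.
split; [split|] => /=; first split.
- rewrite mdot_mvec !(dotDl, dotZl, dotNl, dotDr, dotZr, dotNr) pp.
  by field; lra.
- rewrite mvec0 pp (_ : _ - 1 = k ^+ 2 * n + 1); last by field; lra.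
  by rewrite addr_gt0// mulr_gt0// exprn_gt0.
- rewrite mdot_mvec !(dotDl, dotZl, dotNl, dotDr, dotZr, dotNr) (dotC p q) pp.
  by field; lra.
- rewrite mdot_mvec !(dotDl, dotZl, dotNl, dotDr, dotZr, dotNr) (dotC p q) pp nn.
  by field; lra.
Qed.

Definition R_plus (R : realType) (w : ('rV[R]_4 * 'rV[R]_4) * R) :
    'rV[R]_4 * 'rV[R]_4 :=
  let r := w.1.1 in let s := w.1.2 in let k := w.2 in
  let s0 := s 0 0 in
  (cosh s0 *: r - sinh s0 *: s,
   - (sinh s0 / k) *: r + (cosh s0 / k) *: s).

Definition phi_plus (R : realType) (z : 'rV[R]_3 * 'rV[R]_3) : 'rV[R]_4 * 'rV[R]_4 :=
  R_plus (S_plus z).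

Definition kepler_orbit (R : realType) (J : set R)
    (c : R -> 'rV[R]_3 * 'rV[R]_3) : Prop :=
  forall t, J t ->
    [/\ (c t).1 != 0,
        is_derive t 1 (fun u => (c u).1) (c t).2 &
        is_derive t 1 (fun u => (c u).2) (- (enorm (c t).1) ^- 3 *: (c t).1)].

(* Norm of the eccentricity (Laplace-Runge-Lenz) vector p x (q x p) - q/|q|,
   with the double cross product expanded as |p|^2 q - <q,p> p. *)
Definition eccentricity (R : realType) (z : 'rV[R]_3 * 'rV[R]_3) : R :=
  enorm (dot z.2 z.2 *: z.1 - dot z.1 z.2 *: z.2 - (enorm z.1)^-1 *: z.1).

Definition periapsis_at_0 (R : realType) (J : set R)
    (c : R -> 'rV[R]_3 * 'rV[R]_3) : Prop :=
  forall t, J t -> enorm (c 0).1 <= enorm (c t).1.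

(* The energy and the eccentricity are first integrals; they are read off at
   t = 0. The relation for |q| alone determines psi only up to a sign on each
   side of t = 0; the relation for M removes this ambiguity. *)
Definition hyperbolic_anomalies (R : realType) (J : set R)
    (c : R -> 'rV[R]_3 * 'rV[R]_3)
    (psi M : R -> R) : Prop :=
  let a := (2 * energy (c 0))^-1 in
  let e := eccentricity (c 0) in
  [/\ {within J, continuous psi},
      psi 0 = 0,
      forall t, J t -> enorm (c t).1 = a * (e * cosh (psi t) - 1),
      forall t, J t -> M t = e * sinh (psi t) - psi t &
      forall t, J t -> M t = a `^ (- (3 / 2)) * t].

(* A geodesic of the pseudo-Riemannian submanifold H3: the ambient acceleration
   is normal to the tangent space at each point. *)
Definition geodesic_H3 (R : realType) (g : R -> 'rV[R]_4) : Prop :=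
  [/\ forall t, H3 (g t),
      forall t, derivable g t 1,
      forall t, derivable g^`()%classic t 1 &
      forall t (v : 'rV[R]_4), mdot (g t) v = 0 -> mdot (g^`(2)%classic t) v = 0].

(* Main.v *)
(* S_+ is a diffeomorphism onto the part r_0 > 1 of T_1^*H x R_{>0}, with an
   explicit inverse. R_+ is a hyperbolic rotation by -s_0 in the plane of
   (r, s), followed by a rescaling; inverting it means recovering the angle t
   from (x, k y), i.e. solving Kepler's equation t = x_0 sinh t + k y_0 cosh t.
   On N_+ one has x_0^2 - (k y_0)^2 >= 1, so the right-hand side minus t is
   strictly increasing, and its derivative r_0 - 1 vanishes only where x_0 = 1;
   hence the solution is unique and, by the implicit function theorem, smooth.
   For the symplectic form, the rotation gives
     <dx /\ dy> = k^-1 <dr /\ ds> - k^-2 (<dr, s> + ds_0) /\ dk,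
   and this is sum_i dq_i /\ dp_i by computing with scalar products of q, p.
   Along a Kepler orbit r' = -(k/|q|) s and s' = -(k/|q|) r, which turns into
   x' = k^3 (k y) and (k y)' = k^3 x. So (x, k y) is the hyperbolic rotation of
   (r(0), s(0)) by k^3 t = M_h; comparing the components s_0 gives
   s_0 = e sinh (s_0 + M_h), so that s_0 + M_h = -psi_h by uniqueness in
   Kepler's equation. *)

Require Import Defs.
From HB Require Import structures.
From mathcomp Require Import all_boot all_order all_algebra.
From mathcomp Require Import all_classical all_reals all_analysis.
From mathcomp Require Import ring lra.
Import Order.TTheory GRing.Theory Num.Theory.
Import numFieldNormedType.Exports.
Local Open Scope classical_set_scope.
Local Open Scope ring_scope.

Set Implicit Arguments.
Unset Strict Implicit.
Unset Printing Implicit Defensive.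

(** * Calculus of C^k maps *)

(** The first-order expansion of [f] at [x] is also one of [g], because both sides agree for small
    increments. *)
Lemma differentiable_near_eq {R : realType} {V W : normedModType R}
    (f g : V -> W) (x : V) :
  (\near x, f x = g x) -> differentiable f x -> differentiable g x.
Proof.
move=> fg df.
have E : g \o shift x = cst (g x) + 'd f x +o_ 0 id.
  apply/eqaddoP => e e0.
  have /eqaddoP /(_ e e0) := diff_locally df.
  have fg0 : \forall h \near (0 : V), f (h + x) = g (h + x).
    have := fg; rewrite (near_shift 0) subr0 /=.
    by apply: filterS => y /=.
  have fgx := nbhs_singleton fg.
  move: fg0; apply: filterS2 => h /= e1.
  rewrite !fctE /= -e1 -fgx; exact.
apply/diff_locallyP; rewrite (diff_unique (diff_continuous df) E); split => //.
exact: (diff_continuous df).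
Qed.

(** A product rule with one factor merely continuous: since [f x = 0], the term f(y) (g(y) - g(x))
    is o(y - x), and only g(x) f(y) contributes to the derivative. It serves to differentiate an
    implicitly defined function. *)
Lemma differentiable_mul0 {R : realType} {V : normedModType R} (f g : V -> R) (x : V) :
  differentiable f x -> f x = 0 -> {for x, continuous g} ->
  differentiable (fun y => f y * g y) x /\
  (forall v, 'D_v (fun y => f y * g y) x = g x * 'D_v f x).
Proof.
move=> df fx0 cg.
have E : (fun y => f y * (g y - g x)) \o shift x = cst 0 +o_ 0 id.
  apply/eqaddoP => e e0.
  (* The expansion of [f] at its zero [x] gives a linear bound: the constant is the Lipschitz
     constant of the differential plus 1 for the remainder. *)
  have [k k0 Hk] : exists2 k : R, 0 < k & \forall h \near (0 : V), `|f (h + x)| <= k * `|h|.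
    have h1 : f \o shift x = cst 0 + 'd f x +o_ 0 id.
      by have := diff_locally df; rewrite fx0.
    have /eqaddoP /(_ 1 ltr01) h2 := h1.
    have [c c0 Hc] := linear_lipschitz (diff_continuous df).
    exists (c + 1); first by rewrite addr_gt0.
    move: h2; apply: filterS => h /=; rewrite !fctE /= add0r mul1r => hh.
    rewrite mulrDl mul1r -[X in `|X|](subrK ('d f x h)).
    rewrite (le_trans (ler_normD _ _))// addrC lerD//.
  have /cvgrPdist_le /(_ (e / k)) : g y @[y --> x] --> g x by exact: cg.
  rewrite divr_gt0// => /(_ isT) cg'.
  have cg0 : \forall h \near (0 : V), `|g x - g (h + x)| <= e / k.
    by have := near_shift 0 x [set t | `|g x - g t| <= e / k]; rewrite subr0 /= => <-.
  move: Hk cg0; apply: filterS2 => h /= h1 h2.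
  rewrite !fctE /= subr0 normrM.
  rewrite distrC in h2.
  rewrite (le_trans (ler_pM _ _ h1 h2))//.
  by rewrite mulrAC mulrCA divff ?gt_eqF// mulr1 .
have d1 : differentiable (fun y => f y * (g y - g x)) x /\
  'd (fun y => f y * (g y - g x)) x = 0 :> (V -> R).
  pose z : {linear V -> R} := \0.
  have zc : continuous z by exact: cst_continuous.
  have E' : (fun y => f y * (g y - g x)) \o shift x =
    cst (f x * (g x - g x)) + z +o_ 0 id.
    by rewrite subrr mulr0 addr0.
  split; last exact: (diff_unique zc E').
  by apply/diff_locallyP; rewrite (diff_unique zc E').
have d2 : differentiable (fun y => g x * f y) x.
  exact: (differentiableZ (g x) df).
have Ef : (fun y => f y * g y) =
  (fun y => f y * (g y - g x)) + (fun y => g x * f y).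
  by apply/funext => y; rewrite fctE; ring.
split; first by rewrite Ef; apply: differentiableD => //; case: d1.
move=> v; rewrite Ef deriveD; last 2 first.
- by apply: diff_derivable; case: d1.
- exact: diff_derivable.
rewrite deriveE ?d1.2 /= ?add0r; last by case: d1.
by rewrite [LHS](deriveZ (g x) (diff_derivable _)).
Qed.

Lemma subset_Ck {R : realType} (V W : normedModType R) (A B : set V) k (f : V -> W) :
  A `<=` B -> Ck B k f -> Ck A k f.
Proof.
move=> AB; elim: k f => [|k IH] f /=; first by move=> cf x /AB; exact: cf.
by move=> [df Df]; split=> [x /AB|v]; [exact: df|exact: IH].
Qed.

Section Ck_theory.
Context {R : realType} {V : normedModType R} (U : set V).

Lemma CkW (W : normedModType R) k (f : V -> W) : Ck U k.+1 f -> Ck U k f.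
Proof.
elim: k f => [|k IH] f [df Df].
  by move=> x Ux; apply: differentiable_continuous; exact: df.
by split=> // v; exact: IH.
Qed.

Lemma Ck_cst (W : normedModType R) k (w : W) : Ck U k (fun _ : V => w).
Proof.
elim: k w => [|k IH] w /=; first by move=> x _; exact: cst_continuous.
split=> [x _|v]; first exact: differentiable_cst.
rewrite (_ : (fun x => 'D_v (fun=> w) x) = fun=> 0)//.
by apply/funext => x; exact: derive_cst.
Qed.

Lemma Ck_lin k (f : {linear V -> R}) : continuous f -> Ck U k f.
Proof.
move=> cf; case: k => [|k] /=; first by move=> x _; exact: cf.
split=> [x _|v]; first exact: linear_differentiable.
rewrite (_ : (fun x => 'D_v f x) = fun=> f v); first exact: Ck_cst.
apply/funext => x; rewrite deriveE; last exact: linear_differentiable.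
by rewrite diff_lin.
Qed.

Hypothesis oU : open U.

(** Since [U] is open, two maps equal on [U] are equal near each of its points, hence so are their
    directional derivatives there, and the induction goes through. *)
Lemma eq_Ck (W : normedModType R) k (f g : V -> W) :
  (forall x, U x -> f x = g x) -> Ck U k f -> Ck U k g.
Proof.
have nU x : U x -> \near x, U x by move=> Ux; exact: open_nbhs_nbhs.
elim: k f g => [|k IH] f g fg /=.
  move=> cf x Ux; have fgx : \near x, f x = g x.
    by apply: filterS (nU x Ux) => y; exact: fg.
  have := cf _ Ux; rewrite /prop_for /continuous_at -(fg _ Ux) => h.
  by apply: cvg_trans h; apply: near_eq_cvg; apply: filterS fgx => y ->.
case=> df Df; split=> [x Ux|v].
  apply: differentiable_near_eq (df _ Ux).
  by apply: filterS (nU x Ux) => y; exact: fg.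
apply: IH (Df v) => x Ux; apply: near_eq_derive.
by apply: filterS (nU x Ux) => y; exact: fg.
Qed.

Lemma CkD (W : normedModType R) k (f g : V -> W) :
  Ck U k f -> Ck U k g -> Ck U k (fun x => f x + g x).
Proof.
elim: k f g => [|k IH] f g /=.
  by move=> cf cg x Ux; apply: continuousD; [exact: cf|exact: cg].
move=> [df Df] [dg Dg]; split=> [x Ux|v].
  exact: (differentiableD (df _ Ux) (dg _ Ux)).
apply: (eq_Ck _ (IH _ _ (Df v) (Dg v))) => x Ux.
by rewrite -deriveD//; apply: diff_derivable; [exact: df|exact: dg].
Qed.

Lemma CkM k (f g : V -> R) :
  Ck U k f -> Ck U k g -> Ck U k (fun x => f x * g x).
Proof.
elim: k f g => [|k IH] f g /=.
  by move=> cf cg x Ux; apply: continuousM; [exact: cf|exact: cg].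
move=> [df Df] [dg Dg]; split=> [x Ux|v].
  exact: (differentiableM (df _ Ux) (dg _ Ux)).
have Cf : Ck U k f by apply: CkW; split.
have Cg : Ck U k g by apply: CkW; split.
apply: (eq_Ck _ (CkD (IH _ _ Cf (Dg v)) (IH _ _ Cg (Df v)))) => x Ux.
have -> : (fun x => f x * g x) = f * g by [].
by rewrite deriveM//; apply: diff_derivable; [exact: df|exact: dg].
Qed.

Lemma CkZl (W : normedModType R) k (f : V -> R) (w : W) :
  Ck U k f -> Ck U k (fun x => f x *: w).
Proof.
elim: k f => [|k IH] f /=.
  by move=> cf x Ux; apply: continuousZr_tmp; exact: cf.
move=> [df Df]; split=> [x Ux|v].
  exact: differentiableZl (df _ Ux).
apply: (eq_Ck _ (IH _ (Df v))) => x Ux.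
have dfx := df _ Ux.
by rewrite (deriveE _ dfx) (deriveE _ (differentiableZl w dfx)) (diffZl w dfx).
Qed.

Lemma CkN k (f : V -> R) : Ck U k f -> Ck U k (fun x => - f x).
Proof.
move=> Cf; apply: (eq_Ck _ (CkM (Ck_cst k (-1 : R)) Cf)) => x _.
by rewrite mulN1r.
Qed.

Lemma CkB k (f g : V -> R) :
  Ck U k f -> Ck U k g -> Ck U k (fun x => f x - g x).
Proof. by move=> Cf Cg; apply: CkD => //; exact: CkN. Qed.

Lemma Ck_sum (W : normedModType R) k n (f : 'I_n -> V -> W) :
  (forall i, Ck U k (f i)) -> Ck U k (fun x => \sum_(i < n) f i x).
Proof.
elim: n f => [|n IH] f Cf.
  by apply: (eq_Ck _ (Ck_cst k 0)) => x _; rewrite big_ord0.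
apply: (eq_Ck _ (CkD (IH _ (fun i => Cf (widen_ord (leqnSn n) i))) (Cf ord_max))).
by move=> x _; rewrite big_ord_recr.
Qed.

(** Along v the derivative of h(f x) is dh(f x) times that of f. For the exponential, the inverse
    and the square root, [dh] is an expression in [h] itself, so an induction on the order of
    differentiability closes. *)
Lemma Ck_chain k (h dh : R -> R) (f : V -> R) :
  (forall x, U x -> is_derive (f x) 1 h (dh (f x))) ->
  Ck U k.+1 f -> Ck U k (fun x => dh (f x)) -> Ck U k.+1 (fun x => h (f x)).
Proof.
move=> dhf [df Df] Cdh.
have dh' x : U x -> differentiable h (f x).
  by move=> Ux; apply/derivable1_diffP; case: (dhf _ Ux).
split=> [x Ux|v].
  by apply: (@differentiable_comp _ _ _ _ f h); [exact: df|exact: dh'].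
apply: (eq_Ck _ (CkM Cdh (Df v))) => x Ux.
have dfx := df _ Ux; have dhx := dh' _ Ux.
have dc : differentiable (h \o f) x by exact: differentiable_comp.
rewrite (deriveE _ dfx) [RHS](deriveE _ dc) (diff_comp dfx dhx) /=.
(* On the real line the differential of [h] is multiplication by its value at 1, which is the
   derivative. *)
rewrite -[X in _ = 'd h _ X]mulr1 [RHS]linearZ /= -(deriveE _ dhx).
by have [_ ->] := dhf _ Ux; rewrite mulrC.
Qed.

Lemma Ck_expR k (f : V -> R) : Ck U k f -> Ck U k (fun x => expR (f x)).
Proof.
elim: k f => [|k IH] f.
  move=> cf x Ux; apply: continuous_comp; first exact: cf.
  exact: continuous_expR.
move=> Cf; apply: (Ck_chain (dh := expR)) => //.
exact/IH/CkW.
Qed.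

Lemma CkV k (f : V -> R) : (forall x, U x -> f x != 0) ->
  Ck U k f -> Ck U k (fun x => (f x)^-1).
Proof.
move=> f0; elim: k => [|k IH] => [cf x Ux|Cf].
  by apply: continuousV; [exact: f0|exact: cf].
apply: (Ck_chain (h := GRing.inv) (dh := fun y => - (y^-1 * y^-1))) => //.
  move=> x Ux; apply: is_derive_eq.
    exact: (is_deriveV (f := id) (f0 _ Ux)).
  by rewrite /= expr2 invfM [LHS]mulr1.
by apply: CkN; apply: CkM; apply: IH; exact: CkW.
Qed.

Lemma Ck_sqrt k (f : V -> R) : (forall x, U x -> 0 < f x) ->
  Ck U k f -> Ck U k (fun x => Num.sqrt (f x)).
Proof.
move=> f0; elim: k => [|k IH] => [cf x Ux|Cf].
  apply: continuous_comp; first exact: cf.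
  exact: sqrt_continuous.
apply: (Ck_chain (h := Num.sqrt) (dh := fun y => (2 * Num.sqrt y)^-1)) => //.
  by move=> x Ux; apply: is_derive1_sqrt; exact: f0.
apply: CkV => [x Ux|].
  by rewrite mulf_neq0// gt_eqF// sqrtr_gt0 f0.
by apply: CkM; [exact: Ck_cst|apply: IH; exact: CkW].
Qed.

Lemma Ck_cosh k (f : V -> R) : Ck U k f -> Ck U k (fun x => cosh (f x)).
Proof.
move=> Cf; apply: CkM; last exact: Ck_cst.
by apply: CkD; apply: Ck_expR => //; exact: CkN.
Qed.

Lemma Ck_sinh k (f : V -> R) : Ck U k f -> Ck U k (fun x => sinh (f x)).
Proof.
move=> Cf; apply: CkM; last exact: Ck_cst.
by apply: CkB; apply: Ck_expR => //; exact: CkN.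
Qed.

End Ck_theory.

(** * Hyperbolic functions and Kepler's equation *)

Section hyperbolic.
Context {R : realType}.
Implicit Types s t h a b : R.

Lemma cosh_gt0 s : 0 < cosh s.
Proof. by rewrite /cosh divr_gt0// addr_gt0// expR_gt0. Qed.

Lemma cosh2_sinh2 s : cosh s ^+ 2 - sinh s ^+ 2 = 1.
Proof.
rewrite /cosh /sinh expRN; have := expR_gt0 s; set e := expR s => e0.
by field; rewrite gt_eqF.
Qed.

Lemma coshN s : cosh (- s) = cosh s.
Proof. by rewrite /cosh opprK addrC. Qed.

Lemma sinhN s : sinh (- s) = - sinh s.
Proof. by rewrite /sinh opprK -mulNr opprB. Qed.

Lemma cosh0 : cosh 0 = 1 :> R.
Proof. by rewrite /cosh oppr0 expR0; field. Qed.

Lemma sinh0 : sinh 0 = 0 :> R.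
Proof. by rewrite /sinh oppr0 subrr mul0r. Qed.

Lemma coshD s t : cosh (s + t) = cosh s * cosh t + sinh s * sinh t.
Proof.
rewrite /cosh /sinh opprD !expRD !expRN.
have := expR_gt0 s; have := expR_gt0 t.
set e := expR s; set f := expR t => f0 e0.
by field; rewrite !gt_eqF.
Qed.

Lemma sinhD s t : sinh (s + t) = sinh s * cosh t + cosh s * sinh t.
Proof.
rewrite /cosh /sinh opprD !expRD !expRN.
have := expR_gt0 s; have := expR_gt0 t.
set e := expR s; set f := expR t => f0 e0.
by field; rewrite !gt_eqF.
Qed.

Lemma is_derive_sinh s : is_derive s 1 (@sinh R) (cosh s).
Proof.
have -> : @sinh R = (fun t => (2:R)^-1 *: (expR t - expR (- t))).
  by apply/funext => t; rewrite /sinh mulrC.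
apply: is_derive_eq.
by rewrite /cosh [LHS]mulrC /= mulrN1 opprK.
Qed.

Lemma is_derive_cosh s : is_derive s 1 (@cosh R) (sinh s).
Proof.
have -> : @cosh R = (fun t => (2:R)^-1 *: (expR t + expR (- t))).
  by apply/funext => t; rewrite /cosh mulrC.
apply: is_derive_eq.
by rewrite /sinh [LHS]mulrC /= mulrN1.
Qed.

Lemma sinh_continuous : continuous (@sinh R).
Proof.
by move=> x; apply/differentiable_continuous/derivable1_diffP; case: (is_derive_sinh x).
Qed.

Lemma cosh_continuous : continuous (@cosh R).
Proof.
by move=> x; apply/differentiable_continuous/derivable1_diffP; case: (is_derive_cosh x).
Qed.

Lemma cosh_gt1 s : s != 0 -> 1 < cosh s.
Proof.
move=> s0; rewrite /cosh expRN; have e0 := expR_gt0 s.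
have : expR s != 1 by rewrite -expR0; apply: contra s0 => /eqP/expR_inj ->.
set e := expR s in e0 * => e1.
have : 0 < (e - 1) ^+ 2 by rewrite exprn_even_gt0//= subr_eq0.
move=> h; rewrite -subr_gt0.
have -> : (e + e^-1) / 2 - 1 = (e - 1) ^+ 2 / (2 * e).
  by field; rewrite gt_eqF.
by rewrite divr_gt0// mulr_gt0.
Qed.

(** Mean value theorem for sinh t - t, whose derivative cosh t - 1 is positive away from 0. *)
Lemma sinh_gt s : 0 < s -> s < sinh s.
Proof.
move=> s0.
have dg (x : R) : is_derive x 1 (fun t => sinh t - t) (cosh x - 1).
  by apply: is_deriveB; exact: is_derive_sinh.
have [|c] := @MVT R _ (fun x => cosh x - 1) 0 s s0 (fun x _ => dg x).
  apply: derivable_within_continuous => x _; by case: (dg x).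
rewrite in_itv /= => /andP[c0 _].
rewrite sinh0 !subr0 => E.
by rewrite -subr_gt0 E mulr_gt0// subr_gt0 cosh_gt1// gt_eqF.
Qed.

End hyperbolic.

(* Kepler's equation [s = a sinh s + b cosh s]; with e = sqrt (a^2 - b^2) and
   (a, b) = e (cosh d, sinh d), it reads e sinh (s + d) = s. *)
Definition kepler_fun {R : realType} (a b s : R) : R :=
  a * sinh s + b * cosh s - s.

Section kepler.
Context {R : realType}.
Implicit Types a b s t : R.

(** The two factors have product at least 1 and sum 2a > 0. *)
Lemma kepler_coeff_gt0 a b : 0 < a -> 1 <= a ^+ 2 - b ^+ 2 -> 0 < a + b /\ 0 < a - b.
Proof. by move=> a0 ab; split; nra. Qed.

(** This is the derivative of [kepler_fun] plus 1. It is positive because a + b and a - b are, and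
    its square is a^2 - b^2 + (a sinh s + b cosh s)^2 >= 1. *)
Lemma cosh_comb_ge1 a b s : 0 < a -> 1 <= a ^+ 2 - b ^+ 2 ->
  1 <= a * cosh s + b * sinh s.
Proof.
move=> a0 ab; have [p0 m0] := kepler_coeff_gt0 a0 ab.
have K0 : 0 < a * cosh s + b * sinh s.
  have -> : a * cosh s + b * sinh s = ((a + b) * expR s + (a - b) * expR (- s)) / 2.
    by rewrite /cosh /sinh; field.
  by rewrite divr_gt0// addr_gt0// mulr_gt0// expR_gt0.
have : (a * cosh s + b * sinh s) ^+ 2 - (a * sinh s + b * cosh s) ^+ 2 =
   (a ^+ 2 - b ^+ 2) * (cosh s ^+ 2 - sinh s ^+ 2) by ring.
rewrite cosh2_sinh2 mulr1 => E.
have := sqr_ge0 (a * sinh s + b * cosh s).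
nra.
Qed.

(** With midpoint m and half-length h of [s, t], the increment is 2 ((a cosh m + b sinh m) sinh h -
    h), at least 2 (sinh h - h) > 0. Strictness thus holds even where the derivative vanishes. *)
Lemma kepler_fun_lt a b s t : 0 < a -> 1 <= a ^+ 2 - b ^+ 2 ->
  s < t -> kepler_fun a b s < kepler_fun a b t.
Proof.
move=> a0 ab st.
pose h := (t - s) / 2; pose m := (t + s) / 2.
have h0 : 0 < h by rewrite divr_gt0// subr_gt0.
have -> : s = m - h by rewrite /m /h; field.
have -> : t = m + h by rewrite /m /h; field.
rewrite /kepler_fun !(sinhD, coshD, sinhN, coshN).
have := sinh_gt h0; have := cosh_comb_ge1 m a0 ab.
set C := cosh m; set S := sinh m; set k := sinh h; set c := cosh h.
nra.
Qed.

Lemma kepler_fun_inj a b s t : 0 < a -> 1 <= a ^+ 2 - b ^+ 2 ->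
  kepler_fun a b s = kepler_fun a b t -> s = t.
Proof.
move=> a0 ab E; have [/(kepler_fun_lt a0 ab)|/(kepler_fun_lt a0 ab)|//] := ltgtP s t;
  by rewrite E ltxx.
Qed.

Lemma kepler_fun_gt0 a b : 0 < a -> 1 <= a ^+ 2 - b ^+ 2 ->
  exists2 t, 0 < t & 0 < kepler_fun a b t.
Proof.
move=> a0 ab; have [p0 m0] := kepler_coeff_gt0 a0 ab.
(* [T] satisfies (a + b) T = 4 (1 + (a - b)) + (a + b); the bound exp T >= 1 + T^2 / 2 then
   outweighs both the decaying exponential and the linear term. *)
pose T := 4 / (a + b) * (1 + (a - b)) + 1.
have T0 : 1 < T by rewrite /T ltrDr mulr_gt0// ?divr_gt0// addr_gt0.
exists T; first lra.
have : 1 + T ^+ 2 / 2 <= expR T.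
  by apply: (@expR_ge1Dxn R T 1); lra.
have eN : expR (- T) < 1 by rewrite expR_lt1; lra.
have -> : kepler_fun a b T = ((a + b) * expR T - (a - b) * expR (- T)) / 2 - T.
  by rewrite /kepler_fun /cosh /sinh; field.
set E := expR T; set F := expR (- T) in eN *.
have PT : (a + b) * T = 4 * (1 + (a - b)) + (a + b) by rewrite /T; field; lra.
move=> hE.
have h1 : (a + b) * (1 + T ^+ 2 / 2) <= (a + b) * E by rewrite ler_pM2l.
have h2 : (a - b) * F <= (a - b) by nra.
have h3 : (a + b) * (T ^+ 2) = (4 * (1 + (a - b)) + (a + b)) * T.
  by rewrite -PT; ring.
nra.
Qed.

Lemma kepler_fun_continuous a b : continuous (kepler_fun a b).
Proof.
move=> x; apply: cvgB; last exact: cvg_id.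
apply: cvgD; apply: cvgM.
- exact: cvg_cst.
- exact: sinh_continuous.
- exact: cvg_cst.
- exact: cosh_continuous.
Qed.

(** Intermediate value theorem; the negative value comes from the symmetry (b, s) -> (-b, -s), which
    changes the sign of [kepler_fun]. *)
Lemma kepler_sol_exists a b : 0 < a -> 1 <= a ^+ 2 - b ^+ 2 ->
  exists s, kepler_fun a b s = 0.
Proof.
move=> a0 ab.
have [t t0 ft] := kepler_fun_gt0 a0 ab.
have [u u0 fu] : exists2 u, 0 < u & 0 < kepler_fun a (- b) u.
  by apply: kepler_fun_gt0 => //; rewrite sqrrN.
have fu' : kepler_fun a b (- u) < 0.
  rewrite (_ : _ b _ = - kepler_fun a (- b) u) ?oppr_lt0//.
  by rewrite /kepler_fun sinhN coshN; ring.
have [|||c _ fc] := @IVT R (kepler_fun a b) (- u) t 0.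
- lra.
- exact/continuous_subspaceT/kepler_fun_continuous.
- have h := lt_trans fu' ft.
  by rewrite minEle maxEle (ltW h) (ltW fu') (ltW ft).
- by exists c.
Qed.

End kepler.

(** * Smooth dependence of the solution of Kepler's equation *)

Section kepler_implicit.
Context {R : realType} {V : normedModType R}.
Variables (U : set V) (a b tau : V -> R).
Hypothesis oU : open U.
Hypothesis a_gt0 : forall x, U x -> 0 < a x.
Hypothesis ab_ge1 : forall x, U x -> 1 <= a x ^+ 2 - b x ^+ 2.
Hypothesis tau_sol : forall x, U x -> kepler_fun (a x) (b x) (tau x) = 0.
Hypothesis tau_reg : forall x, U x -> 1 < a x * cosh (tau x) + b x * sinh (tau x).

(** At tau(x) - e and tau(x) + e the Kepler function at [x] has strict opposite signs. These persist
    for nearby [y], and monotonicity traps tau(y) in between. *)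
Lemma kepler_sol_continuous : Ck U 0 a -> Ck U 0 b -> Ck U 0 tau.
Proof.
move=> ca cb x Ux; apply/cvgrPdist_lt => e e0.
have nU : \near x, U x by exact: open_nbhs_nbhs.
have cF s : {for x, continuous (fun y => kepler_fun (a y) (b y) s)}.
  rewrite /prop_for /continuous_at; apply: cvgB; last exact: cvg_cst.
  by apply: cvgD; (apply: cvgM; last exact: cvg_cst); [exact: ca|exact: cb].
have Fm : kepler_fun (a x) (b x) (tau x - e) < 0.
  rewrite -(tau_sol Ux); apply: kepler_fun_lt; [exact: a_gt0|exact: ab_ge1|lra].
have Fp : 0 < kepler_fun (a x) (b x) (tau x + e).
  rewrite -[X in X < _](tau_sol Ux).
  apply: kepler_fun_lt; [exact: a_gt0|exact: ab_ge1|lra].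
pose F s y := kepler_fun (a y) (b y) s.
have nm : \forall y \near x, F (tau x - e) y < 0 by exact: cvgr_lt (cF _) _ Fm.
have np : \forall y \near x, 0 < F (tau x + e) y by exact: cvgr_gt (cF _) _ Fp.
move: nU nm np; apply: filterS3 => y Uy ym yp.
have mono s t : s <= t -> F s y <= F t y.
  rewrite le_eqVlt => /predU1P[->//|st]; apply/ltW/kepler_fun_lt => //.
  - exact: a_gt0.
  - exact: ab_ge1.
have F0 : F (tau y) y = 0 by exact: tau_sol.
rewrite ltr_distlC; apply/andP; split; rewrite ltNge; apply/negP => /mono.
- by rewrite F0 leNgt ym.
- by rewrite F0 leNgt yp.
Qed.

(** Implicit differentiation by Caratheodory's criterion. With sinh(tau y) - sinh(tau x) = Q1(tau y)
    (tau y - tau x), and likewise [Q2] for cosh, subtracting the Kepler equations at [y] and [x]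
    gives D(y) (tau y - tau x) = (a y - a x) sinh(tau y) + (b y - b x) cosh(tau y). [D] is
    continuous and, by [tau_reg], negative at [x]; after division, [differentiable_mul0] applies to
    each term. *)
Lemma kepler_sol_diff x : U x -> {for x, continuous tau} ->
  differentiable a x -> differentiable b x ->
  differentiable tau x /\
  forall v, 'D_v tau x = (1 - (a x * cosh (tau x) + b x * sinh (tau x)))^-1 *
    (sinh (tau x) * 'D_v a x + cosh (tau x) * 'D_v b x).
Proof.
move=> Ux ct da db.
have /is_derive1_caratheodory [Q1 [Q1E Q1c Q1x]] := is_derive_sinh (tau x).
have /is_derive1_caratheodory [Q2 [Q2E Q2c Q2x]] := is_derive_cosh (tau x).
pose D y := 1 - (a x * Q1 (tau y) + b x * Q2 (tau y)).
have Dx : D x = 1 - (a x * cosh (tau x) + b x * sinh (tau x)).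
  by rewrite /D Q1x Q2x.
have Dx0 : D x < 0 by rewrite Dx; have := tau_reg Ux; lra.
have cD : {for x, continuous D}.
  apply: cvgB; first exact: cvg_cst.
  apply: cvgD; apply: cvgM; try exact: cvg_cst.
  - exact: (continuous_comp ct Q1c).
  - exact: (continuous_comp ct Q2c).
have cI : {for x, continuous (fun y => (D y)^-1)}.
  by apply: continuousV => //; rewrite lt_eqF.
have cS : {for x, continuous (fun y => (D y)^-1 * sinh (tau y))}.
  apply: cvgM => //; apply: (continuous_comp ct); exact: sinh_continuous.
have cC : {for x, continuous (fun y => (D y)^-1 * cosh (tau y))}.
  apply: cvgM => //; apply: (continuous_comp ct); exact: cosh_continuous.
have dac : differentiable (fun y => a y - a x) x.
  exact: (differentiableB da (differentiable_cst _ _)).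
have dbc : differentiable (fun y => b y - b x) x.
  exact: (differentiableB db (differentiable_cst _ _)).
have [d1 D1] := differentiable_mul0 dac (subrr _) cS.
have [d2 D2] := differentiable_mul0 dbc (subrr _) cC.
(* The divided equation, solved for tau(y); it equals [tau] wherever [D] is negative and y lies in
   [U]. *)
pose g := cst (tau x) + ((fun y => (a y - a x) * ((D y)^-1 * sinh (tau y))) +
   (fun y => (b y - b x) * ((D y)^-1 * cosh (tau y)))).
have dg : differentiable g x by apply: differentiableD => //; exact: differentiableD.
have gE : \forall y \near x, g y = tau y.
  have nU : \near x, U x by exact: open_nbhs_nbhs.
  have nD : \forall y \near x, D y < 0 by exact: cvgr_lt cD _ Dx0.
  move: nU nD; apply: filterS2 => y Uy Dy.
  have := tau_sol Uy; have := tau_sol Ux; rewrite /kepler_fun => e0 e1.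
  have := Q1E (tau y); have := Q2E (tau y) => e2 e3.
  rewrite /g !fctE.
  apply/eqP; rewrite -subr_eq0 -(mulrI_eq0 _ (mulfI (ltr0_neq0 Dy))); apply/eqP.
  transitivity (D y * (tau x - tau y) + (a y - a x) * sinh (tau y) +
    (b y - b x) * cosh (tau y)).
    by field; rewrite lt_eqF.
  rewrite /D.
  transitivity (tau x - tau y + a x * (Q1 (tau y) * (tau y - tau x)) +
      b x * (Q2 (tau y) * (tau y - tau x))  + (a y - a x) * sinh (tau y) +
    (b y - b x) * cosh (tau y)); first by ring.
  rewrite -e2 -e3; lra.
split; first exact: differentiable_near_eq gE dg.
move=> v; rewrite -(near_eq_derive _ gE) /g.
rewrite deriveD; [|exact: derivable_cst|by apply: diff_derivable; exact: differentiableD].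
rewrite derive_cst add0r deriveD; [|exact: diff_derivable|exact: diff_derivable].
rewrite D1 D2.
have -> : 'D_v (fun y => a y - a x) x = 'D_v a x.
  have -> : (fun y => a y - a x) = a - cst (a x) by [].
  by rewrite deriveB ?derive_cst ?subr0//; exact: diff_derivable.
have -> : 'D_v (fun y => b y - b x) x = 'D_v b x.
  have -> : (fun y => b y - b x) = b - cst (b x) by [].
  by rewrite deriveB ?derive_cst ?subr0//; exact: diff_derivable.
by rewrite -Dx; ring.
Qed.

(** Bootstrap: the formula for the derivative involves only [tau], the coefficients and their
    derivatives, so a C^k solution has C^k derivatives. *)
Lemma kepler_sol_Ck k : Ck U k a -> Ck U k b -> Ck U k tau.
Proof.
elim: k => [|k IH] Ca Cb; first exact: kepler_sol_continuous.
have {}IH : Ck U k tau by apply: IH; exact: CkW.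
have ct : Ck U 0 tau.
  elim: {Ca Cb} k IH => // k IH Ct; exact/IH/CkW.
have dt x : U x -> _ := fun Ux => kepler_sol_diff Ux (ct x Ux) (Ca.1 x Ux) (Cb.1 x Ux).
split=> [x Ux|v]; first by case: (dt x Ux).
apply: (eq_Ck oU (f := fun x =>
   (1 - (a x * cosh (tau x) + b x * sinh (tau x)))^-1 *
    (sinh (tau x) * 'D_v a x + cosh (tau x) * 'D_v b x))).
  by move=> x Ux; rewrite (dt x Ux).2.
have Ca' := CkW Ca; have Cb' := CkW Cb.
apply: CkM => //.
  apply: CkV => //.
    by move=> x Ux; rewrite lt_eqF//; have := tau_reg Ux; lra.
  apply: CkB => //; first exact: Ck_cst.
  by apply: CkD => //; apply: CkM => //; [exact: Ck_cosh|exact: Ck_sinh].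
apply: CkD => //; apply: CkM => //; [exact: Ck_sinh|exact: Ca.2|exact: Ck_cosh|exact: Cb.2].
Qed.

End kepler_implicit.

(** * Euclidean and Minkowski products *)

Section dot_theory.
Context {R : realType}.
Implicit Types (u v w : 'rV[R]_3) (a : R).

Lemma dotC u v : dot u v = dot v u.
Proof. by apply: eq_bigr => i _; rewrite mulrC. Qed.

Lemma dotDl u v w : dot (u + v) w = dot u w + dot v w.
Proof. by rewrite /dot -big_split; apply: eq_bigr => i _; rewrite mxE mulrDl. Qed.

Lemma dotZl a u v : dot (a *: u) v = a * dot u v.
Proof. by rewrite /dot mulr_sumr; apply: eq_bigr => i _; rewrite mxE mulrA. Qed.

Lemma dotNl u v : dot (- u) v = - dot u v.
Proof. by rewrite -scaleN1r dotZl mulN1r. Qed.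

Lemma dotDr u v w : dot w (u + v) = dot w u + dot w v.
Proof. by rewrite dotC dotDl !(dotC w). Qed.

Lemma dotZr a u v : dot v (a *: u) = a * dot v u.
Proof. by rewrite dotC dotZl (dotC v). Qed.

Lemma dotNr u v : dot v (- u) = - dot v u.
Proof. by rewrite dotC dotNl (dotC v). Qed.

Lemma dot0r u : dot u 0 = 0.
Proof. by rewrite -(scale0r 0) dotZr mul0r. Qed.

Definition dotE := (dotDl, dotNl, dotZl, dotDr, dotNr, dotZr).

Lemma dot_ge0 u : 0 <= dot u u.
Proof. by apply: sumr_ge0 => i _; rewrite -expr2 sqr_ge0. Qed.

Lemma dot_eq0 u : (dot u u == 0) = (u == 0).
Proof.
apply/eqP/eqP => [/psumr_eq0P d0|->].
  apply/rowP => i; rewrite mxE; apply/eqP; rewrite -sqrf_eq0 expr2 d0// => j _.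
  by rewrite -expr2 sqr_ge0.
by rewrite /dot big1// => i _; rewrite mxE mul0r.
Qed.

Lemma dot_gt0 u : (0 < dot u u) = (u != 0).
Proof. by rewrite lt_def dot_eq0 dot_ge0 andbT. Qed.

(** The squared length of (v.v) u - (u.v) v is v.v times the difference of the two sides. *)
Lemma dot_CauchySchwarz u v : dot u v ^+ 2 <= dot u u * dot v v.
Proof.
have [->|v0] := eqVneq v 0.
  by rewrite !dot0r expr0n mulr0.
have vv : 0 < dot v v by rewrite dot_gt0.
have := dot_ge0 (dot v v *: u - dot u v *: v).
rewrite !dotE (dotC v u) => h.
rewrite -subr_ge0 -(pmulr_rge0 _ vv); apply: le_trans h _.
by rewrite le_eqVlt; apply/orP; left; apply/eqP; ring.
Qed.

Lemma enorm_gt0 u : (0 < enorm u) = (u != 0).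
Proof. by rewrite sqrtr_gt0 dot_gt0. Qed.

Lemma sqr_enorm u : enorm u ^+ 2 = dot u u.
Proof. by rewrite sqr_sqrtr// dot_ge0. Qed.

End dot_theory.

Section mdot_theory.
Context {R : realType}.
Implicit Types (x y z r s : 'rV[R]_4) (a t : R).

Definition spatial x : 'rV[R]_3 := \row_i x 0 (lift ord0 i).

Lemma spatial_mvec a (v : 'rV[R]_3) : spatial (mvec a v) = v.
Proof. by apply/rowP => i; rewrite mxE mvecS. Qed.

Lemma mvec_eqP x y : x 0 0 = y 0 0 -> spatial x = spatial y -> x = y.
Proof.
move=> e0 es; apply/rowP => i; have [j ->|->//] := unliftP ord0 i.
by have /rowP/(_ j) := es; rewrite !mxE.
Qed.

Lemma mvec_spatial x : mvec (x 0 0) (spatial x) = x.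
Proof. by apply: mvec_eqP; rewrite ?mvec0 ?spatial_mvec. Qed.

Lemma mdotE x y : mdot x y = x 0 0 * y 0 0 - dot (spatial x) (spatial y).
Proof. by rewrite -[x in LHS]mvec_spatial -[y in LHS]mvec_spatial mdot_mvec. Qed.

Lemma spatialD x y : spatial (x + y) = spatial x + spatial y.
Proof. by apply/rowP => i; rewrite !mxE. Qed.

Lemma spatialZ a x : spatial (a *: x) = a *: spatial x.
Proof. by apply/rowP => i; rewrite !mxE. Qed.

Lemma mdotC x y : mdot x y = mdot y x.
Proof. by rewrite !mdotE mulrC dotC. Qed.

Lemma mdotDl x y z : mdot (x + y) z = mdot x z + mdot y z.
Proof. by rewrite !mdotE spatialD dotDl mxE; ring. Qed.

Lemma mdotZl a x y : mdot (a *: x) y = a * mdot x y.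
Proof. by rewrite !mdotE spatialZ dotZl mxE; ring. Qed.

Lemma mdotNl x y : mdot (- x) y = - mdot x y.
Proof. by rewrite -scaleN1r mdotZl mulN1r. Qed.

Lemma mdotDr x y z : mdot z (x + y) = mdot z x + mdot z y.
Proof. by rewrite mdotC mdotDl !(mdotC z). Qed.

Lemma mdotZr a x y : mdot y (a *: x) = a * mdot y x.
Proof. by rewrite mdotC mdotZl (mdotC y). Qed.

Lemma mdotNr x y : mdot y (- x) = - mdot y x.
Proof. by rewrite mdotC mdotNl (mdotC y). Qed.

Definition mdot_simp := (mdotDl, mdotNl, mdotZl, mdotDr, mdotNr, mdotZr).

(** Cauchy-Schwarz for the spatial parts reads (r_0 s_0)^2 <= (r_0^2 - 1) (s_0^2 + 1). This supplies
    the condition on the coefficients of Kepler's equation. *)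
Lemma T1H3_sqr_le r s : T1H3 (r, s) -> 1 + s 0 0 ^+ 2 <= r 0 0 ^+ 2.
Proof.
rewrite /T1H3 /TH3 /H3 /= !mdotE => -[[[rr r0] rs] ss].
have := dot_CauchySchwarz (spatial r) (spatial s).
have -> : dot (spatial r) (spatial s) = r 0 0 * s 0 0 by lra.
have -> : dot (spatial r) (spatial r) = r 0 0 ^+ 2 - 1 by lra.
have -> : dot (spatial s) (spatial s) = s 0 0 ^+ 2 + 1 by lra.
by nra.
Qed.

(** Cauchy-Schwarz gives x_0^2 <y, y> <= - |Y|^2 for the spatial part Y of [y], and Y = 0 would
    force y_0 = 0 by orthogonality to [x]. *)
Lemma TH3_spacelike x y : TH3 (x, y) -> y != 0 -> mdot y y < 0.
Proof.
rewrite /TH3 /H3 /= !mdotE => -[[xx x0] xy] y0.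
have CS := dot_CauchySchwarz (spatial x) (spatial y).
have xyE : dot (spatial x) (spatial y) = x 0 0 * y 0 0 by lra.
have xxE : dot (spatial x) (spatial x) = x 0 0 ^+ 2 - 1 by lra.
rewrite xyE xxE in CS.
have yy : 0 < dot (spatial y) (spatial y).
  rewrite dot_gt0; apply: contra y0 => /eqP sy0.
  have /eqP : x 0 0 * y 0 0 = 0 by rewrite -xyE sy0 dot0r.
  rewrite mulf_eq0 gt_eqF//= => /eqP y00.
  apply/eqP/mvec_eqP; first by rewrite y00 mxE.
  by rewrite sy0; apply/rowP => i; rewrite !mxE.
set b := dot _ _ in CS yy *; set a := y 0 0 in CS *.
have h : x 0 0 ^+ 2 * (a * a - b) < 0 by nra.
have x2 : 0 < x 0 0 ^+ 2 by rewrite exprn_gt0.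
by rewrite -(pmulr_rlt0 _ x2).
Qed.

(** On [T1H3] this is the unit-speed geodesic flow at time [t], acting on pairs of a point and its
    velocity. *)
Definition hrot t (w : 'rV[R]_4 * 'rV[R]_4) : 'rV[R]_4 * 'rV[R]_4 :=
  (cosh t *: w.1 + sinh t *: w.2, sinh t *: w.1 + cosh t *: w.2).

Lemma hrot0 w : hrot 0 w = w.
Proof. by case: w => r s; rewrite /hrot cosh0 sinh0 !scale1r !scale0r addr0 add0r. Qed.

Lemma hrotD (t' t : R) w : hrot (t' + t) w = hrot t' (hrot t w).
Proof.
rewrite /hrot coshD sinhD /=; congr pair; apply/rowP => i; rewrite !mxE; ring.
Qed.

(** The products are preserved by cosh^2 - sinh^2 = 1; staying on the upper sheet uses
    [cosh_comb_ge1]. *)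
Lemma T1H3_hrot t w : T1H3 w -> T1H3 (hrot t w).
Proof.
case: w => r s h; have rs2 := T1H3_sqr_le h.
move: h; rewrite /T1H3 /TH3 /H3 /= !mdot_simp => -[[[rr r0] rs] ss].
rewrite (mdotC s r) rs rr ss !mxE.
have E := cosh2_sinh2 t; have c0 := cosh_gt0 t.
split; [split; [split|]|].
- by rewrite -[RHS]E; ring.
- have -> : cosh t * r 0 0 + sinh t * s 0 0 = r 0 0 * cosh t + s 0 0 * sinh t by ring.
  by apply: lt_le_trans (cosh_comb_ge1 t r0 _); rewrite ?ltr01//; lra.
- by ring.
- by rewrite -[in RHS]E; ring.
Qed.

End mdot_theory.

(** * The inverses of R_+ and S_+ *)

Section inverse.
Context {R : realType}.
Local Notation V3 := 'rV[R]_3.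
Local Notation V4 := 'rV[R]_4.
Implicit Types (z : V3 * V3) (w : V4 * V4) (k : R).

Lemma R_plusE w k : R_plus (w, k) =
  ((hrot (- w.2 0 0) w).1, k^-1 *: (hrot (- w.2 0 0) w).2).
Proof.
rewrite /R_plus /hrot coshN sinhN /=; congr pair.
  by rewrite scaleNr.
by rewrite scalerDr !scalerA mulrN scaleNr -scaleNr !(mulrC k^-1).
Qed.

Lemma R_plus_hrot w k : k != 0 ->
  ((R_plus (w, k)).1, k *: (R_plus (w, k)).2) = hrot (- w.2 0 0) w.
Proof.
move=> k0; rewrite R_plusE [RHS]surjective_pairing; congr pair.
by rewrite scalerA divff// scale1r.
Qed.

(** The value is 0 if there is no solution; for 0 < a and 1 <= a^2 - b^2 there is exactly one. *)
Definition kepler_sol (a b : R) : R := xget 0 [set s | kepler_fun a b s = 0].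

Lemma kepler_solP a b : 0 < a -> 1 <= a ^+ 2 - b ^+ 2 ->
  kepler_fun a b (kepler_sol a b) = 0.
Proof.
move=> a0 ab; have [s sP] := kepler_sol_exists a0 ab.
by apply: (@xgetPex _ 0 [set s | kepler_fun a b s = 0]); exists s.
Qed.

Lemma kepler_solE a b s : 0 < a -> 1 <= a ^+ 2 - b ^+ 2 ->
  kepler_fun a b s = 0 -> kepler_sol a b = s.
Proof.
move=> a0 ab sP; apply: (kepler_fun_inj a0 ab).
by rewrite sP; exact: kepler_solP.
Qed.

(** Recovers k = sqrt(2H) from [y], since <y, y> = -1/k^2 on the image of R_+. *)
Definition unit_scale w : R := (Num.sqrt (- mdot w.2 w.2))^-1.

(** The angle undoing R_+ must equal the zeroth component s_0 of the vector it produces; this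
    self-consistency is Kepler's equation with coefficients x_0 and k y_0. *)
Definition R_inv w : (V4 * V4) * R :=
  let k := unit_scale w in
  (hrot (kepler_sol (w.1 0 0) (k * w.2 0 0)) (w.1, k *: w.2), k).

Lemma T1H3_coeffs w : T1H3 w ->
  0 < w.1 0 0 /\ 1 <= w.1 0 0 ^+ 2 - w.2 0 0 ^+ 2.
Proof.
case: w => r s h; have := T1H3_sqr_le h; move: h => [[[_ /= r0] _] _] ?.
by split => //; lra.
Qed.

Lemma hrot1E t w : (hrot t w).1 0 0 = w.1 0 0 * cosh t + w.2 0 0 * sinh t.
Proof. by rewrite !mxE mulrC; congr (_ + _); rewrite mulrC. Qed.

(** Hence the second vector, rotated by [t], has zeroth component [t] exactly when [t] solves
    Kepler's equation. *)
Lemma hrot2E t w : (hrot t w).2 0 0 = kepler_fun (w.1 0 0) (w.2 0 0) t + t.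
Proof. by rewrite /kepler_fun !mxE; ring. Qed.

Lemma unit_scaleP w : N_plus w ->
  0 < unit_scale w /\ T1H3 (w.1, unit_scale w *: w.2).
Proof.
case: w => x y [/= TH y0 _]; have yy := TH3_spacelike TH y0.
rewrite /unit_scale /=; set k := (Num.sqrt _)^-1.
have k0 : 0 < k by rewrite invr_gt0 sqrtr_gt0 oppr_gt0.
have kk : k ^+ 2 * mdot y y = -1.
  rewrite /k exprVn sqr_sqrtr ?oppr_ge0 ?ltW//; field; lra.
split => //; move: TH => [H xy].
split; first by split => //=; rewrite mdotZr xy mulr0.
by rewrite /= !mdot_simp mulrA -expr2.
Qed.

Lemma R_invP w : N_plus w ->
  [/\ T1H3 (R_inv w).1, 0 < (R_inv w).2, 1 < (R_inv w).1.1 0 0 &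
      R_plus (R_inv w) = w].
Proof.
move=> Nw; have [k0 T1] := unit_scaleP Nw.
case: w Nw k0 T1 => x y [/= _ _ x1]; rewrite /R_inv /=.
set k := unit_scale _ => k0 T1.
have [x0 xk] := T1H3_coeffs T1; rewrite /= mxE in x0 xk.
set t := kepler_sol _ _.
have tP : kepler_fun (x 0 0) (k * y 0 0) t = 0 by exact: kepler_solP.
have T2 := T1H3_hrot t T1.
have s0 : (hrot t (x, k *: y)).2 0 0 = t by rewrite hrot2E /= mxE tP add0r.
split => //.
(* r_0 = 1 would force s_0 = 0 by [T1H3_sqr_le]; then the angle is 0 and x_0 = r_0 = 1, which
   [N_plus] excludes. *)
- rewrite lt_neqAle; apply/andP; split; last first.
    by rewrite [leRHS](hrot1E t (x, k *: y)) /= mxE; exact: cosh_comb_ge1.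
  apply: contra x1 => /eqP r1.
  have := T1H3_sqr_le T2; rewrite s0 -[X in _ <= X ^+ 2]r1 => h.
  have t0 : t = 0 by apply/eqP; rewrite -sqrf_eq0 eq_le sqr_ge0 andbT; lra.
  apply/eqP; transitivity ((hrot t (x, k *: y)).1 0 0); last exact: esym.
  by rewrite t0 hrot0.
- rewrite R_plusE s0 -hrotD addNr hrot0 /= scalerA mulVf ?scale1r//.
  by rewrite gt_eqF.
Qed.

Lemma R_plusP w k : T1H3 w -> 0 < k -> 1 < w.1 0 0 ->
  N_plus (R_plus (w, k)) /\ R_inv (R_plus (w, k)) = (w, k).
Proof.
move=> T1 k0 r1.
rewrite R_plusE; set t := - w.2 0 0.
have T2 := T1H3_hrot t T1.
have wE : w = hrot (- t) (hrot t w) by rewrite -hrotD addNr hrot0.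
have [x0 xk] := T1H3_coeffs T2.
have tP : kepler_fun ((hrot t w).1 0 0) ((hrot t w).2 0 0) (- t) = 0.
  by apply: (addIr (- t)); rewrite -hrot2E -wE opprK add0r.
case E : (hrot t w) => [x y]; rewrite E /= in T2 wE x0 xk tP *.
have yy : mdot y y = -1 by case: T2.
split.
  split => /=.
  - by move: T2 => [[H xy] _]; split => //=; rewrite mdotZr xy mulr0.
  - rewrite scaler_eq0 invr_eq0 gt_eqF//=; apply/eqP => y0.
    by move: yy; rewrite y0 -(scale0r 0) mdotZl mul0r; lra.
  (* If x_0 = 1 then y_0 = 0, and Kepler's equation with coefficients 1 and 0 has only the solution
     0. No rotation took place, and r_0 = x_0 contradicts r_0 > 1. *)
  - apply/eqP => x1.
    have := T1H3_sqr_le T2; rewrite x1 => h.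
    have y00 : y 0 0 = 0 by apply/eqP; rewrite -sqrf_eq0 eq_le sqr_ge0 andbT; lra.
    have t0 : - t = 0.
      apply: (kepler_fun_inj x0 xk); rewrite tP y00 /kepler_fun sinh0 cosh0; lra.
    by move: r1; rewrite wE t0 hrot0 /= x1 ltxx.
rewrite /R_inv /unit_scale /= !mdot_simp yy.
have -> : (Num.sqrt (- (k^-1 * (k^-1 * -1))))^-1 = k.
  by rewrite (_ : - _ = k^-1 ^+ 2) ?sqrtr_sqr ?normfV ?invrK ?gtr0_norm//; ring.
rewrite mxE mulrA scalerA divff ?gt_eqF// mul1r scale1r.
by rewrite (kepler_solE _ _ tP)//= -wE.
Qed.

(** On the image of S_+ one has r_0 - 1 = k^2 |q|. The spatial part -k |q| p of r then yields p, and
    s_0 times it minus (r_0 - 1) times the spatial part of s equals k^2 q. *)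
Definition S_inv (d : (V4 * V4) * R) : V3 * V3 :=
  let r := d.1.1 in let s := d.1.2 in let k := d.2 in
  (k ^- 2 *: (s 0 0 *: spatial r - (r 0 0 - 1) *: spatial s),
   - (k / (r 0 0 - 1)) *: spatial r).

(** Indeed r_0 - 1 = 2 |q| H. *)
Lemma S_plus_gt1 z : Sigma_plus z -> 1 < (S_plus z).1.1 0 0.
Proof.
case: z => q p [/= q0 H0]; rewrite mvec0.
have n0 : 0 < enorm q by rewrite enorm_gt0.
have h : 0 < enorm q * energy (q, p) by rewrite mulr_gt0.
have hE : enorm q * energy (q, p) = (dot p p * enorm q - 2) / 2.
  by rewrite /energy /=; field; lra.
lra.
Qed.

(** The energy relation, in the form used to eliminate |p|^2 from identities that are then rational
    in k, |q| and the other scalar products. *)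
Lemma sqr_energy (q p : V3) (k := Num.sqrt (2 * energy (q, p))) : Sigma_plus (q, p) ->
  [/\ 0 < enorm q, 0 < k & dot p p = k ^+ 2 + 2 / enorm q].
Proof.
move=> [/= q0 H0].
have n0 : 0 < enorm q by rewrite enorm_gt0.
split => //; first by rewrite sqrtr_gt0 mulr_gt0.
rewrite sqr_sqrtr ?mulr_ge0 ?ltW// /energy /=; field; lra.
Qed.

Lemma S_plusK z : Sigma_plus z -> S_inv (S_plus z) = z.
Proof.
case: z => q p Sz; have [n0 k0 pp] := sqr_energy Sz.
rewrite /S_inv /S_plus /= !mvec0 !spatial_mvec.
set n := enorm q in n0 pp *; set k := Num.sqrt _ in k0 pp *.
have -> : dot p p * n - 1 - 1 = k ^+ 2 * n by rewrite pp; field; lra.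
by congr pair; apply/rowP => i; rewrite !mxE; field; lra.
Qed.

(** The constraints of [T1H3] determine the spatial products: |r|^2 = a^2 - 1, <r, s> = a b, |s|^2 =
    b^2 + 1. They give |q| = (a - 1)/k^2, |p|^2 and <q, p> = -b/k, hence 2H = k^2. *)
Lemma S_invP w k : T1H3 w -> 1 < w.1 0 0 -> 0 < k ->
  Sigma_plus (S_inv (w, k)) /\ S_plus (S_inv (w, k)) = (w, k).
Proof.
case: w => r s; rewrite /T1H3 /TH3 /H3 /= !mdotE => -[[[rr _] rs] ss] r1 k0.
rewrite /S_inv /=; set q := (_ ^- 2 *: _); set p := (_ *: spatial r).
set a := r 0 0 in rr rs r1 q p *; set b := s 0 0 in rs ss q *.
have qq : dot q q = ((a - 1) / k ^+ 2) ^+ 2.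
  rewrite /q !dotE (dotC (spatial s)).
  have -> : dot (spatial r) (spatial r) = a ^+ 2 - 1 by lra.
  have -> : dot (spatial r) (spatial s) = a * b by lra.
  have -> : dot (spatial s) (spatial s) = b ^+ 2 + 1 by lra.
  by field; lra.
have pp : dot p p = k ^+ 2 * (a + 1) / (a - 1).
  rewrite /p !dotE.
  have -> : dot (spatial r) (spatial r) = a ^+ 2 - 1 by lra.
  by field; lra.
have qp : dot q p = - b / k.
  rewrite /q /p !dotE (dotC (spatial s)).
  have -> : dot (spatial r) (spatial r) = a ^+ 2 - 1 by lra.
  have -> : dot (spatial r) (spatial s) = a * b by lra.
  by field; lra.
have nq : enorm q = (a - 1) / k ^+ 2.
  by rewrite /enorm qq sqrtr_sqr ger0_norm// divr_ge0 ?sqr_ge0//; lra.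
have n0 : 0 < enorm q by rewrite nq divr_gt0 ?exprn_gt0//; lra.
have HE : 2 * energy (q, p) = k ^+ 2.
  by rewrite /energy /= pp nq; field; lra.
split; first by split; [rewrite -enorm_gt0|have := exprn_gt0 2 k0; lra].
have kE : Num.sqrt (2 * energy (q, p)) = k by rewrite HE sqrtr_sqr gtr0_norm.
rewrite /S_plus /= kE qp pp nq; congr ((_, _), _); apply: mvec_eqP.
- by rewrite mvec0 -/a; field; lra.
- by rewrite spatial_mvec; apply/rowP => i; rewrite !mxE; field; lra.
- by rewrite mvec0 -/b; field; lra.
- by rewrite spatial_mvec; apply/rowP => i; rewrite !mxE; field; lra.
Qed.

Lemma phi_plusP z : Sigma_plus z ->
  N_plus (phi_plus z) /\ S_inv (R_inv (phi_plus z)) = z.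
Proof.
move=> Sz; have [T1 k0] := S_plus_T1H3 Sz.
have := R_plusP T1 k0 (S_plus_gt1 Sz).
by rewrite -surjective_pairing => -[h1 h2]; rewrite /phi_plus h2 S_plusK.
Qed.

Lemma phi_invP w : N_plus w ->
  Sigma_plus (S_inv (R_inv w)) /\ phi_plus (S_inv (R_inv w)) = w.
Proof.
move=> Nw; have [T1 k0 r1 wE] := R_invP Nw.
have := S_invP T1 r1 k0; rewrite -surjective_pairing => -[h1 h2].
by split => //; rewrite /phi_plus h2.
Qed.

End inverse.

(** * C^k maps with values in row vectors *)

Section row_Ck.
Context {R : realType} {V : normedModType R} (U : set V).
Hypothesis oU : open U.

(** Componentwise, so that the rules for real-valued maps apply; [Ck_rows] returns to vector-valued
    maps. *)
Definition row_Ck n k (f : V -> 'rV[R]_n) := forall i, Ck U k (fun x => f x 0 i).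

Lemma row_CkD n k (f g : V -> 'rV[R]_n) :
  row_Ck k f -> row_Ck k g -> row_Ck k (fun x => f x + g x).
Proof.
move=> Cf Cg i; apply: (eq_Ck oU _ (CkD oU (Cf i) (Cg i))) => x _.
by rewrite mxE.
Qed.

Lemma row_CkZ n k (a : V -> R) (f : V -> 'rV[R]_n) :
  Ck U k a -> row_Ck k f -> row_Ck k (fun x => a x *: f x).
Proof.
move=> Ca Cf i; apply: (eq_Ck oU _ (CkM oU Ca (Cf i))) => x _.
by rewrite mxE.
Qed.

Lemma row_CkN n k (f : V -> 'rV[R]_n) :
  row_Ck k f -> row_Ck k (fun x => - f x).
Proof.
by move=> Cf i; apply: (eq_Ck oU _ (CkN oU (Cf i))) => x _; rewrite mxE.
Qed.

Lemma row_Ck_mvec k (a : V -> R) (f : V -> 'rV[R]_3) :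
  Ck U k a -> row_Ck k f -> row_Ck k (fun x => mvec (a x) (f x)).
Proof.
move=> Ca Cf i; have [j ->|->] := unliftP ord0 i.
- by apply: (eq_Ck oU _ (Cf j)) => x _; rewrite mvecS.
- by apply: (eq_Ck oU _ Ca) => x _; rewrite mvec0.
Qed.

Lemma row_Ck_spatial k (f : V -> 'rV[R]_4) :
  row_Ck k f -> row_Ck k (fun x => spatial (f x)).
Proof.
by move=> Cf i; apply: (eq_Ck oU _ (Cf (lift ord0 i))) => x _; rewrite mxE.
Qed.

Lemma Ck_dot k (f g : V -> 'rV[R]_3) :
  row_Ck k f -> row_Ck k g -> Ck U k (fun x => dot (f x) (g x)).
Proof. by move=> Cf Cg; apply: (Ck_sum oU) => i; exact: CkM. Qed.

Lemma Ck_enorm k (f : V -> 'rV[R]_3) : (forall x, U x -> f x != 0) ->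
  row_Ck k f -> Ck U k (fun x => enorm (f x)).
Proof.
move=> f0 Cf; apply: Ck_sqrt => //; last exact: Ck_dot.
by move=> x Ux; rewrite dot_gt0 f0.
Qed.

Lemma Ck_mdot k (f g : V -> 'rV[R]_4) :
  row_Ck k f -> row_Ck k g -> Ck U k (fun x => mdot (f x) (g x)).
Proof.
move=> Cf Cg; apply: (CkB oU); first exact: CkM.
by apply: (Ck_sum oU) => i; exact: CkM.
Qed.

(** The map is a finite sum of real coordinate functions times constant basis vectors. *)
Lemma Ck_rows m n k (f : V -> 'rV[R]_m * 'rV[R]_n) :
  row_Ck k (fun x => (f x).1) -> row_Ck k (fun x => (f x).2) -> Ck U k f.
Proof.
move=> C1 C2.
have D1 : Ck U k (fun x => \sum_(i < m) (f x).1 0 i *: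
    ((delta_mx 0 i, 0) : 'rV[R]_m * 'rV[R]_n)).
  by apply: (Ck_sum oU) => i; exact: CkZl.
have D2 : Ck U k (fun x => \sum_(i < n) (f x).2 0 i *:
    ((0, delta_mx 0 i) : 'rV[R]_m * 'rV[R]_n)).
  by apply: (Ck_sum oU) => i; exact: CkZl.
apply: (eq_Ck oU _ (CkD oU D1 D2)) => x _.
rewrite [RHS](_ : _ = ((f x).1, 0) + (0, (f x).2)); last first.
  by rewrite [f x]surjective_pairing /=; congr pair; rewrite ?addr0 ?add0r.
congr (_ + _).
- rewrite [X in (X, _)]row_sum_delta.
  by elim/big_rec2: _ => // i a b _ ->; congr pair; rewrite /= scaler0 addr0.
- rewrite [X in (_, X)]row_sum_delta.
  by elim/big_rec2: _ => // i a b _ ->; congr pair; rewrite /= scaler0 addr0.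
Qed.

Lemma open_pos (f : V -> R) : Ck U 0 f -> open [set x | U x /\ 0 < f x].
Proof.
move=> cf; rewrite openE => x [Ux fx].
have nU : \near x, U x by exact: open_nbhs_nbhs.
have nf : \forall y \near x, 0 < f y by exact: cvgr_gt (cf _ Ux) _ fx.
by apply: filterS2 nU nf => y.
Qed.

End row_Ck.

(** * Coordinate functionals as continuous linear maps *)

Section coordinates.
Context {R : realType} (m n : nat).
Local Notation W := ('rV[R]_m * 'rV[R]_n)%type.

Definition coord1 i (z : W) : R := z.1 0 i.
Definition coord2 i (z : W) : R := z.2 0 i.

Lemma coord1_is_linear i : linear (coord1 i).
Proof. by move=> a x y; rewrite /coord1 /= !mxE. Qed.

Lemma coord2_is_linear i : linear (coord2 i).
Proof. by move=> a x y; rewrite /coord2 /= !mxE. Qed.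

HB.instance Definition _ i :=
  GRing.isLinear.Build R W R _ (coord1 i) (coord1_is_linear i).
HB.instance Definition _ i :=
  GRing.isLinear.Build R W R _ (coord2 i) (coord2_is_linear i).

Lemma coord1_continuous i : continuous (coord1 i).
Proof.
move=> z; apply: (continuous_comp (g := fun x : 'rV_m => x 0 i)).
  exact: cvg_fst.
exact: coord_continuous.
Qed.

Lemma coord2_continuous i : continuous (coord2 i).
Proof.
move=> z; apply: (continuous_comp (g := fun x : 'rV_n => x 0 i)).
  exact: cvg_snd.
exact: coord_continuous.
Qed.

Lemma coord1_diff i z : is_diff z (coord1 i) (coord1 i).
Proof.
split; first by apply: linear_differentiable; exact: coord1_continuous.
by apply: diff_lin; exact: coord1_continuous.
Qed.

Lemma coord2_diff i z : is_diff z (coord2 i) (coord2 i).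
Proof.
split; first by apply: linear_differentiable; exact: coord2_continuous.
by apply: diff_lin; exact: coord2_continuous.
Qed.

Lemma row_Ck_fst (U : set W) k : row_Ck U k (fun z => z.1).
Proof. by move=> i; exact: (Ck_lin U k (@coord1_continuous i)). Qed.

Lemma row_Ck_snd (U : set W) k : row_Ck U k (fun z => z.2).
Proof. by move=> i; exact: (Ck_lin U k (@coord2_continuous i)). Qed.

End coordinates.

(** * The diffeomorphism *)

Section phi_smooth.
Context {R : realType}.
Local Notation V3 := 'rV[R]_3.
Local Notation V4 := 'rV[R]_4.

Let Q : set (V3 * V3) := [set z | z.1 != 0].

Lemma open_dot_gt0 n (f : 'rV[R]_n * 'rV[R]_n -> V3) :
  row_Ck setT 0 f -> open [set z | f z != 0].
Proof.
move=> Cf; have := open_pos openT (Ck_dot openT Cf Cf).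
by congr open; apply/seteqP; split => z /=; rewrite dot_gt0; [case|].
Qed.

Lemma Ck_energy k : Ck Q k (@energy R).
Proof.
have oQ : open Q by apply: (open_dot_gt0 (f := fst)); exact: row_Ck_fst.
apply: (CkB oQ).
  by apply: (CkM oQ); [apply: (Ck_dot oQ); exact: row_Ck_snd|exact: Ck_cst].
apply: (CkV oQ); first by move=> z Qz; rewrite gt_eqF// enorm_gt0.
by apply: (Ck_enorm oQ) => //; exact: row_Ck_fst.
Qed.

Lemma open_Sigma_plus : open (@Sigma_plus R).
Proof.
apply: open_pos; last exact: Ck_energy.
by apply: (open_dot_gt0 (f := fst)); exact: row_Ck_fst.
Qed.

Lemma row_Ck_S_plus k : let S := @Sigma_plus R in
  [/\ row_Ck S k (fun z => (S_plus z).1.1), row_Ck S k (fun z => (S_plus z).1.2) &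
      Ck S k (fun z => (S_plus z).2)].
Proof.
move=> S; have oS := open_Sigma_plus; rewrite -/S in oS.
have CE : Ck S k (@energy R).
  by apply: subset_Ck (Ck_energy k) => z [].
have Ck2 : Ck S k (fun z => Num.sqrt (2 * energy z)).
  apply: (Ck_sqrt oS); first by move=> z [_ h]; rewrite mulr_gt0.
  by apply: (CkM oS) => //; exact: Ck_cst.
have Cn : Ck S k (fun z => enorm z.1).
  by apply: (Ck_enorm oS) => //; [move=> z []|exact: row_Ck_fst].
have Cb : Ck S k (fun z => dot z.1 z.2).
  by apply: (Ck_dot oS); [exact: row_Ck_fst|exact: row_Ck_snd].
split => //; apply: (row_Ck_mvec oS).
- apply: (CkB oS); last exact: Ck_cst.
  by apply: (CkM oS) => //; apply: (Ck_dot oS); exact: row_Ck_snd.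
- apply: (row_CkZ oS); last exact: row_Ck_snd.
  by apply: (CkN oS); apply: (CkM oS).
- by apply: (CkN oS); apply: (CkM oS).
- apply: (row_CkN oS); apply: (row_CkD oS).
    apply: (row_CkZ oS); last exact: row_Ck_fst.
    apply: (CkV oS) => // z [h _]; by rewrite gt_eqF// enorm_gt0.
  apply: (row_CkN oS); apply: (row_CkZ oS) => //; exact: row_Ck_snd.
Qed.

Lemma phi_plus_smooth : smooth_open (@Sigma_plus R) (@phi_plus R).
Proof.
move=> k; have oS := @open_Sigma_plus; have [Cr Cs Ck2] := row_Ck_S_plus k.
pose S := @Sigma_plus R; rewrite -/S in oS Cr Cs Ck2 *.
have Cs0 := Cs 0.
have CC := Ck_cosh oS Cs0; have CS := Ck_sinh oS Cs0.
have CI : Ck S k (fun z => ((S_plus z).2)^-1).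
  by apply: (CkV oS) => // z /S_plus_T1H3[_ ?]; rewrite gt_eqF.
apply: (Ck_rows oS); apply: (row_CkD oS).
- exact: (row_CkZ oS).
- by apply: (row_CkN oS); exact: (row_CkZ oS).
- by apply: (row_CkZ oS) => //; apply: (CkN oS); exact: (CkM oS).
- by apply: (row_CkZ oS) => //; exact: (CkM oS).
Qed.

(* A smooth retraction of a neighbourhood of N_+ onto N_+; it lets the inverse
   of phi_+ extend smoothly to an open set, as solutions of Kepler's equation
   are unique on N_+ but need not be so off N_+. *)
Definition retract (w : V4 * V4) : V4 * V4 :=
  let x := spatial w.1 in let y := spatial w.2 in
  let x0 := Num.sqrt (1 + dot x x) in
  (mvec x0 x, mvec (dot x y / x0) y).

(** On this open set the retraction makes x_0 = sqrt(1 + |x|^2) greater than 1 and keeps [y]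
    nonzero, so it lands in [N_plus]. *)
Definition retract_dom : set (V4 * V4) :=
  [set w | spatial w.1 != 0] `&` [set w | spatial w.2 != 0].
Local Notation U := retract_dom.

Lemma retract_id w : TH3 w -> retract w = w.
Proof.
case: w => x y [[]] /=; rewrite !mdotE => xx x0 xy; rewrite /retract /=.
have -> : Num.sqrt (1 + dot (spatial x) (spatial x)) = x 0 0.
  by rewrite (_ : 1 + _ = x 0 0 ^+ 2) ?sqrtr_sqr ?gtr0_norm//; lra.
have -> : dot (spatial x) (spatial y) / x 0 0 = y 0 0.
  by rewrite (_ : dot _ _ = x 0 0 * y 0 0); [field; lra|lra].
by rewrite !mvec_spatial.
Qed.

Lemma retract_N_plus w : U w -> N_plus (retract w).
Proof.
case: w => x y [/= x0 y0]; rewrite /retract /=.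
set X := spatial x in x0 *; set Y := spatial y in y0 *.
have XX : 0 < dot X X by rewrite dot_gt0.
set n := Num.sqrt _.
have n1 : 1 < n by rewrite -[X in X < _]sqrtr1 ltr_sqrt; lra.
have nn : n ^+ 2 = 1 + dot X X by rewrite sqr_sqrtr; lra.
split => /=.
- split; [split|] => /=; rewrite ?mdot_mvec ?mvec0; [lra|lra|field; lra].
- apply: contra y0 => /eqP h.
  have := congr1 spatial h; rewrite spatial_mvec => ->.
  by apply/eqP/rowP => i; rewrite !mxE.
- by rewrite mvec0 gt_eqF.
Qed.

(** On the hyperboloid, a vanishing spatial part of [x] means x_0 = 1; one of [y] means x_0 y_0 = 0,
    so [y] = 0. *)
Lemma N_plus_sub_retract_dom : @N_plus R `<=` U.
Proof.
move=> [x y] [/= [[xx x0] xy] y0 x1]; rewrite /= !mdotE in xx xy; split => /=.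
- apply: contra x1 => /eqP h; move: xx; rewrite h dot0r subr0 -expr2 => /eqP.
  by rewrite sqrf_eq1 => /orP[//|/eqP]; lra.
- apply: contra y0 => /eqP h; move: xy; rewrite h dot0r subr0 => /eqP.
  rewrite mulf_eq0 gt_eqF//= => /eqP y00.
  apply/eqP/mvec_eqP; first by rewrite y00 mxE.
  by rewrite h; apply/rowP => i; rewrite !mxE.
Qed.

Lemma open_retract_dom : open U.
Proof.
apply: openI.
  apply: (open_dot_gt0 (f := fun w => spatial w.1)).
  by apply: (row_Ck_spatial openT); exact: row_Ck_fst.
apply: (open_dot_gt0 (f := fun w => spatial w.2)).
by apply: (row_Ck_spatial openT); exact: row_Ck_snd.
Qed.

Lemma row_Ck_retract k : row_Ck U k (fun w => (retract w).1) /\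
  row_Ck U k (fun w => (retract w).2).
Proof.
have oU := open_retract_dom.
have CX : row_Ck U k (fun w => spatial w.1).
  by apply: (row_Ck_spatial oU); exact: row_Ck_fst.
have CY : row_Ck U k (fun w => spatial w.2).
  by apply: (row_Ck_spatial oU); exact: row_Ck_snd.
have pos (x : V3) : 0 < 1 + dot x x by have := dot_ge0 x; lra.
have Cn : Ck U k (fun w => Num.sqrt (1 + dot (spatial w.1) (spatial w.1))).
  apply: (Ck_sqrt oU) => //.
  by apply: (CkD oU); [exact: Ck_cst|exact: (Ck_dot oU)].
split; apply: (row_Ck_mvec oU) => //.
apply: (CkM oU); first exact: (Ck_dot oU).
by apply: (CkV oU) => // w _; rewrite gt_eqF// sqrtr_gt0.
Qed.

Definition phi_inv (w : V4 * V4) : V3 * V3 := S_inv (R_inv (retract w)).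

Lemma phi_inv_smooth : smooth_open U phi_inv.
Proof.
move=> k; have oU := open_retract_dom; have [Cx Cy] := row_Ck_retract k.
have Cl : Ck U k (fun w => unit_scale (retract w)).
  have pos w : U w -> 0 < - mdot (retract w).2 (retract w).2.
    move=> /retract_N_plus; case: (retract w) => x y [/= TH y0 _].
    by rewrite oppr_gt0; exact: TH3_spacelike TH y0.
  apply: (CkV oU); first by move=> w Uw; rewrite gt_eqF// sqrtr_gt0 pos.
  by apply: (Ck_sqrt oU) => //; apply: (CkN oU); exact: (Ck_mdot oU).
have Cb : Ck U k (fun w => unit_scale (retract w) * (retract w).2 0 0).
  exact: (CkM oU).
have scE (v : V4 * V4) : (unit_scale v *: v.2) 0 0 = unit_scale v * v.2 0 0.
  by rewrite mxE.
have Ct : Ck U k (fun w => kepler_sol ((retract w).1 0 0)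
    (unit_scale (retract w) * (retract w).2 0 0)).
  have ab w : U w -> let v := retract w in 0 < v.1 0 0 /\
      1 <= v.1 0 0 ^+ 2 - (unit_scale v * v.2 0 0) ^+ 2.
    move=> /retract_N_plus/unit_scaleP[_ /T1H3_coeffs] /=.
    by rewrite scE.
  apply: (kepler_sol_Ck oU (a := fun w => (retract w).1 0 0) (b := fun w =>
    unit_scale (retract w) * (retract w).2 0 0)) => //.
  - by move=> w /ab[].
  - by move=> w /ab[].
  - by move=> w /ab[? ?]; exact: kepler_solP.
  (* The regularity condition is r_0 > 1, as r_0 is the zeroth component of the rotated first
     vector. *)
  - move=> w /retract_N_plus/R_invP[_ _ + _]; rewrite [ltRHS]hrot1E.
    by rewrite /= scE.
have CC := Ck_cosh oU Ct; have CS := Ck_sinh oU Ct.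
have Cly := row_CkZ oU Cl Cy.
have Cr : row_Ck U k (fun w => (R_inv (retract w)).1.1).
  by apply: (row_CkD oU); exact: (row_CkZ oU).
have Cs : row_Ck U k (fun w => (R_inv (retract w)).1.2).
  by apply: (row_CkD oU); exact: (row_CkZ oU).
have C1 : Ck U k (fun w => (R_inv (retract w)).1.1 0 0 - 1).
  by apply: (CkB oU) => //; exact: Ck_cst.
have l0 w : U w -> 0 < unit_scale (retract w).
  by move=> /retract_N_plus/unit_scaleP[].
apply: (Ck_rows oU).
- apply: (row_CkZ oU).
    apply: (CkV oU); first by move=> w Uw; rewrite expf_neq0// gt_eqF// l0.
    exact: (CkM oU).
  apply: (row_CkD oU).
    by apply: (row_CkZ oU) => //; exact: (row_Ck_spatial oU).
  apply: (row_CkN oU).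
  by apply: (row_CkZ oU) => //; exact: (row_Ck_spatial oU).
- apply: (row_CkZ oU); last exact: (row_Ck_spatial oU).
  apply: (CkN oU); apply: (CkM oU) => //; apply: (CkV oU) => //.
  by move=> w /retract_N_plus/R_invP[_ _ h _]; rewrite gt_eqF// subr_gt0.
Qed.

Lemma phi_plus_diffeomorphism : diffeomorphism (@Sigma_plus R) (@N_plus R) (@phi_plus R).
Proof.
have invE w : N_plus w -> phi_inv w = S_inv (R_inv w).
  by move=> [TH _ _]; rewrite /phi_inv retract_id.
split.
- split.
  + by move=> z /phi_plusP[].
  + move=> z1 z2; rewrite !inE => /phi_plusP[_ {2}<-] /phi_plusP[_ {2}<-] ->//.
  + by move=> w /phi_invP[h1 h2]; exists (S_inv (R_inv w)).
- move=> z Sz; exists (@Sigma_plus R), (@phi_plus R); split => //.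
  + exact: open_Sigma_plus.
  + exact: phi_plus_smooth.
- exists phi_inv; split.
    by move=> z /phi_plusP[h1 h2]; rewrite invE.
  move=> w Nw; exists U, phi_inv; split => //.
  + exact: open_retract_dom.
  + exact: N_plus_sub_retract_dom.
  + exact: phi_inv_smooth.
Qed.

End phi_smooth.

(** * Derivatives of S_+ and R_+ *)

Section row_derive.
Context {R : realType} {V : normedModType R} (x v : V).

(** Reduces directional derivatives to derivatives in one real variable, where the library's chain
    rule for real functions applies. *)
Lemma is_derive_line (W : normedModType R) (f : V -> W) (df : W) :
  is_derive x v f df <-> is_derive (0 : R) 1 (fun h : R => f (h *: v + x)) df.
Proof.
have E : (fun h : R => h^-1 *: (((fun h => f (h *: v + x)) \o shift 0) (h *: (1 : R)) -
    f ((0 : R) *: v + x))) = (fun h => h^-1 *: ((f \o shift x) (h *: v) - f x)).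
  by apply/funext => h /=; rewrite addr0 scale0r add0r [h *: 1]mulr1.
split=> -[d <-]; split.
- by rewrite /derivable E.
- by rewrite /derive E.
- by move: d; rewrite /derivable E.
- by rewrite /derive E.
Qed.

Lemma is_derive_chain (h : R -> R) (f : V -> R) (df dh : R) :
  is_derive x v f df -> is_derive (f x) 1 h dh ->
  is_derive x v (fun y => h (f y)) (dh * df).
Proof.
move=> /is_derive_line Hf Hh; apply/is_derive_line.
apply: (is_derive1_comp (f := h) (g := fun t : R => f (t *: v + x))).
by rewrite scale0r add0r.
Qed.

Lemma is_derive_mul (f g : V -> R) (df dg : R) :
  is_derive x v f df -> is_derive x v g dg ->
  is_derive x v (fun y => f y * g y) (f x * dg + df * g x).
Proof.
move=> Hf Hg; have -> : (fun y => f y * g y) = f * g by [].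
by apply: is_derive_eq; rewrite [df * _]mulrC.
Qed.

Lemma is_derive_inv (f : V -> R) (df : R) :
  is_derive x v f df -> f x != 0 -> is_derive x v (fun y => (f y)^-1) (- (f x) ^- 2 * df).
Proof.
move=> Hf f0; apply: (is_derive_chain (h := GRing.inv)) => //.
apply: is_derive_eq; first exact: (is_deriveV (f := id) f0).
by rewrite [LHS]mulr1.
Qed.

Definition row_derive n (f : V -> 'rV[R]_n) (df : 'rV[R]_n) :=
  forall i, is_derive x v (fun y => f y 0 i) (df 0 i).

Lemma row_deriveD n (f g : V -> 'rV[R]_n) df dg :
  row_derive f df -> row_derive g dg -> row_derive (fun y => f y + g y) (df + dg).
Proof.
move=> Hf Hg i; rewrite mxE.
have -> : (fun y => (f y + g y) 0 i) = (fun y => f y 0 i) + (fun y => g y 0 i).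
  by apply/funext => y; rewrite mxE.
exact: is_deriveD.
Qed.

Lemma row_deriveZ n (a : V -> R) (f : V -> 'rV[R]_n) da df :
  is_derive x v a da -> row_derive f df ->
  row_derive (fun y => a y *: f y) (a x *: df + da *: f x).
Proof.
move=> Ha Hf i; rewrite !mxE.
have -> : (fun y => (a y *: f y) 0 i) = (fun y => a y * f y 0 i).
  by apply/funext => y; rewrite mxE.
exact: is_derive_mul.
Qed.

Lemma row_deriveN n (f : V -> 'rV[R]_n) df :
  row_derive f df -> row_derive (fun y => - f y) (- df).
Proof.
move=> Hf i; rewrite mxE.
have -> : (fun y => (- f y) 0 i) = - (fun y => f y 0 i).
  by apply/funext => y; rewrite mxE.
exact: is_deriveN.
Qed.

Lemma row_derive_mvec (a : V -> R) (f : V -> 'rV[R]_3) da df :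
  is_derive x v a da -> row_derive f df ->
  row_derive (fun y => mvec (a y) (f y)) (mvec da df).
Proof.
move=> Ha Hf i; have [j ->|->] := unliftP ord0 i.
  rewrite mvecS; have -> : (fun y => mvec (a y) (f y) 0 (lift ord0 j)) = (fun y => f y 0 j).
    by apply/funext => y; rewrite mvecS.
  exact: Hf.
rewrite mvec0; have -> // : (fun y => mvec (a y) (f y) 0 0) = a.
by apply/funext => y; rewrite mvec0.
Qed.

Lemma is_derive_dot (f g : V -> 'rV[R]_3) df dg :
  row_derive f df -> row_derive g dg ->
  is_derive x v (fun y => dot (f y) (g y)) (dot (f x) dg + dot df (g x)).
Proof.
move=> Hf Hg; rewrite /dot -big_split /=.
have -> : (fun y => \sum_(i < 3) f y 0 i * g y 0 i) =
    \sum_(i < 3) (fun y => f y 0 i * g y 0 i).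
  by apply/funext => y; rewrite fct_sumE.
by apply: is_derive_sum => i; exact: is_derive_mul.
Qed.

Lemma is_derive_enorm (f : V -> 'rV[R]_3) df : f x != 0 -> row_derive f df ->
  is_derive x v (fun y => enorm (f y)) (dot (f x) df / enorm (f x)).
Proof.
move=> f0 Hf; have n0 : 0 < enorm (f x) by rewrite enorm_gt0.
have d0 : 0 < dot (f x) (f x) by rewrite dot_gt0.
apply: is_derive_eq.
  exact: (is_derive_chain (is_derive_dot Hf Hf) (is_derive1_sqrt d0)).
rewrite -/(enorm (f x)) (dotC df); field; lra.
Qed.

End row_derive.

Section S_derive.
Context {R : realType}.
Local Notation V3 := 'rV[R]_3.
Local Notation V4 := 'rV[R]_4.

Section formulas.
Variables (q p dq dp : V3).
Let n := enorm q.
Let k := Num.sqrt (2 * energy (q, p)).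
Let dn := dot q dq / n.
Let db := dot q dp + dot dq p.

(** Here [dn] and [db] are the derivatives of |q| and <q, p> in the direction (dq, dp). The formula
    for [dS_k] is k k' = H'; [dS_r] and [dS_s] are the derivatives of r and s. *)
Definition dS_k := (dot p dp + dn / n ^+ 2) / k.
Definition dS_r := mvec (2 * dot p dp * n + dot p p * dn)
  (- ((k * n) *: dp + (k * dn + dS_k * n) *: p)).
Definition dS_s := mvec (- (k * db + dS_k * dot q p))
  (- (n^-1 *: dq - (dn / n ^+ 2) *: q - (dot q p *: dp + db *: p))).
End formulas.

Lemma is_derive_energy (V : normedModType R) (x v : V) (Q P : V -> V3) dq dp :
  Q x != 0 -> row_derive x v Q dq -> row_derive x v P dp ->
  is_derive x v (fun y => energy (Q y, P y))
    (dot (P x) dp + dot (Q x) dq / enorm (Q x) ^+ 3).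
Proof.
move=> Q0 HQ HP; have n0 : 0 < enorm (Q x) by rewrite enorm_gt0.
have n1 : enorm (Q x) != 0 by rewrite gt_eqF.
have Hn := is_derive_enorm Q0 HQ.
have Hpp := is_derive_mul (is_derive_dot HP HP) (is_derive_cst (2^-1 : R) x v).
apply: is_derive_eq.
  exact: (is_deriveB Hpp (is_derive_inv Hn n1)).
by rewrite (dotC dp) /=; field; lra.
Qed.

(** The source [V] is arbitrary so as to cover two cases: the phase space, for the differential of
    S_+, and the real line, for the motion along an orbit. *)
Lemma row_derive_S_plus (V : normedModType R) (x v : V) (Q P : V -> V3) dq dp :
  Sigma_plus (Q x, P x) -> row_derive x v Q dq -> row_derive x v P dp ->
  [/\ row_derive x v (fun y => (S_plus (Q y, P y)).1.1) (dS_r (Q x) (P x) dq dp),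
      row_derive x v (fun y => (S_plus (Q y, P y)).1.2) (dS_s (Q x) (P x) dq dp) &
      is_derive x v (fun y => (S_plus (Q y, P y)).2) (dS_k (Q x) (P x) dq dp)].
Proof.
move=> SQP HQ HP; have [n0 k0 pp] := sqr_energy SQP; have [/= Q0 E0] := SQP.
have Hn := is_derive_enorm Q0 HQ.
have Hpp := is_derive_dot HP HP.
have Hb := is_derive_dot HQ HP.
have n1 : enorm (Q x) != 0 by rewrite gt_eqF.
have HE := is_derive_mul (is_derive_cst (2 : R) x v) (is_derive_energy Q0 HQ HP).
have Hk : is_derive x v (fun y => (S_plus (Q y, P y)).2) (dS_k (Q x) (P x) dq dp).
  apply: is_derive_eq.
    by apply: (is_derive_chain HE); apply: is_derive1_sqrt; rewrite mulr_gt0.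
  rewrite /dS_k /=; set k := Num.sqrt _ in k0 *; field; lra.
have Hkn := is_derive_mul Hk Hn.
split => //.
- rewrite /S_plus /= /dS_r.
  apply: row_derive_mvec.
    have Hr := is_derive_mul Hpp Hn.
    have -> : (fun y => dot (P y) (P y) * enorm (Q y) - 1) =
       (fun y => dot (P y) (P y) * enorm (Q y)) - cst 1 by [].
    apply: is_derive_eq.
    by rewrite subr0 (dotC dp); ring.
  have -> : (fun y => - (Num.sqrt (2 * energy (Q y, P y)) * enorm (Q y)) *: P y) =
    (fun y => - ((Num.sqrt (2 * energy (Q y, P y)) * enorm (Q y)) *: P y)).
    by apply/funext => y; rewrite scaleNr.
  exact: (row_deriveN (row_deriveZ Hkn HP)).
- rewrite /S_plus /= /dS_s.
  apply: row_derive_mvec.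
    exact: (is_deriveN (is_derive_mul Hk Hb)).
  have H1 := row_deriveZ (is_derive_inv Hn n1) HQ.
  have H2 := row_deriveN (row_deriveZ Hb HP).
  have := row_deriveN (row_deriveD H1 H2).
  set d := - _; set d' := - (_ - _ - _).
  suff -> : d = d' by [].
  rewrite /d /d'; apply/rowP => i; rewrite !mxE; field; lra.
Qed.

Section tangent.
Variables (q p : V3).
Hypothesis Sqp : Sigma_plus (q, p).
Let r := (S_plus (q, p)).1.1.
Let s := (S_plus (q, p)).1.2.
Let k := (S_plus (q, p)).2.

(** The derivatives of the constraints <r, r> = 1, <s, s> = -1 and <r, s> = 0. *)
Lemma mdot_dS dq dp : let r' := dS_r q p dq dp in let s' := dS_s q p dq dp in
  [/\ mdot r r' = 0, mdot s s' = 0 & mdot r s' = - mdot r' s].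
Proof.
have [n0 k0 pp] := sqr_energy Sqp; rewrite /r /s /S_plus /dS_r /dS_s /dS_k /=.
set n := enorm q in n0 pp *; set K := Num.sqrt _ in k0 pp *.
rewrite !mdot_mvec !dotE (dotC dq) !(dotC dp) !(dotC p q) -(sqr_enorm q) -/n pp.
set b := dot q p; split; field; lra.
Qed.

(** The left side evaluates the form k^-1 <dr /\ ds> - k^-2 (<dr, s> + ds_0) /\ dk on two vectors
    pushed forward by S_+. *)
Lemma omega_S u1 u2 v1 v2 :
  let ru := dS_r q p u1 u2 in let su := dS_s q p u1 u2 in let ku := dS_k q p u1 u2 in
  let rv := dS_r q p v1 v2 in let sv := dS_s q p v1 v2 in let kv := dS_k q p v1 v2 in
  k^-1 * (mdot ru sv - mdot rv su)
  - k ^- 2 * ((mdot ru s + su 0 0) * kv - (mdot rv s + sv 0 0) * ku)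
  = dot u1 v2 - dot v1 u2.
Proof.
have [n0 k0 pp] := sqr_energy Sqp; rewrite /r /s /k /S_plus /dS_r /dS_s /dS_k /=.
set n := enorm q in n0 pp *; set K := Num.sqrt _ in k0 pp *.
(* Each symmetric product is brought into one order, so that [field] sees a single unknown. *)
rewrite !mdot_mvec !mvec0 !dotE (dotC u2 q) (dotC v2 q) (dotC p q).
rewrite (dotC u1 p) (dotC v1 p) (dotC u2 p) (dotC v2 p).
rewrite (dotC u2 v1) (dotC v2 u1) (dotC u2 v2) pp.
set b := dot q p; field; lra.
Qed.

End tangent.

End S_derive.

(** * Pullback of the symplectic form *)

Section symplectic.
Context {R : realType}.
Local Notation V3 := 'rV[R]_3.
Local Notation V4 := 'rV[R]_4.

Lemma omega_minkE (u v : V4 * V4) : omega_mink u v = mdot u.1 v.2 - mdot v.1 u.2.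
Proof.
rewrite /omega_mink /wedge /mdot sumrB; ring.
Qed.

Lemma omega_stdE (u v : V3 * V3) : omega_std u v = dot u.1 v.2 - dot v.1 u.2.
Proof. by rewrite /omega_std /wedge sumrB. Qed.

Section R_derive.
Variables (r s dr ds : V4) (k dk : R).
Let C := cosh (s 0 0).
Let S := sinh (s 0 0).

(** Derivatives of the two components of R_+: the terms with [ds 0 0] come from the varying angle
    s_0, the term with [dk] from the factor 1/k. *)
Definition dR_x : V4 := (C *: dr - S *: ds) + ds 0 0 *: (S *: r - C *: s).
Definition dR_y : V4 :=
  k^-1 *: ((C *: ds - S *: dr) + ds 0 0 *: (S *: s - C *: r))
  - (dk * k ^- 2) *: (C *: s - S *: r).
End R_derive.

Lemma row_derive_R_plus (V : normedModType R) (x v : V) (r s : V -> V4)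
    (k : V -> R) dr ds dk :
  row_derive x v r dr -> row_derive x v s ds -> is_derive x v k dk -> k x != 0 ->
  row_derive x v (fun y => (R_plus ((r y, s y), k y)).1) (dR_x (r x) (s x) dr ds) /\
  row_derive x v (fun y => (R_plus ((r y, s y), k y)).2)
    (dR_y (r x) (s x) dr ds (k x) dk).
Proof.
move=> Hr Hs Hk k0; have Hs0 := Hs 0.
have HC := is_derive_chain Hs0 (is_derive_cosh _).
have HS := is_derive_chain Hs0 (is_derive_sinh _).
have HI := is_derive_inv Hk k0.
split.
- have := row_deriveD (row_deriveZ HC Hr) (row_deriveN (row_deriveZ HS Hs)).
  set d := _ + _; suff -> : d = dR_x (r x) (s x) dr ds by [].
  by rewrite /d /dR_x; apply/rowP => i; rewrite !mxE; ring.
- have := row_deriveD (row_deriveN (row_deriveZ (is_derive_mul HS HI) Hr))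
    (row_deriveZ (is_derive_mul HC HI) Hs).
  set d := _ + _; suff -> : d = dR_y (r x) (s x) dr ds (k x) dk.
    rewrite /R_plus /=; set f := (fun _ => _); set g := (fun _ => _).
    suff -> : f = g by [].
    by apply/funext => y; rewrite /f /g scaleNr.
  by rewrite /d /dR_y; apply/rowP => i; rewrite !mxE; field.
Qed.

Lemma omega_R (r s ru su rv sv : V4) (k ku kv : R) : k != 0 -> T1H3 (r, s) ->
  mdot r ru = 0 -> mdot s su = 0 -> mdot r su = - mdot ru s ->
  mdot r rv = 0 -> mdot s sv = 0 -> mdot r sv = - mdot rv s ->
  omega_mink (dR_x r s ru su, dR_y r s ru su k ku)
             (dR_x r s rv sv, dR_y r s rv sv k kv) =
  k^-1 * (mdot ru sv - mdot rv su)
  - k ^- 2 * ((mdot ru s + su 0 0) * kv - (mdot rv s + sv 0 0) * ku).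
Proof.
move=> k0 [[[/= rr _] rs] ss] ur us urs vr vs vrs.
rewrite omega_minkE /= /dR_x /dR_y !mdot_simp.
rewrite (mdotC ru r) (mdotC rv r) (mdotC su s) (mdotC sv s) (mdotC s r).
rewrite (mdotC s ru) (mdotC s rv) (mdotC su r) (mdotC sv r).
rewrite (mdotC su rv) (mdotC sv ru).
rewrite (mdotC rv ru) (mdotC sv su).
rewrite ur us urs vr vs vrs rr rs ss.
(* With the constraints inserted, the claim is a rational identity in exp(s_0). *)
rewrite /cosh /sinh expRN; have := expR_gt0 (s 0 0).
set e := expR _ => e0; field; rewrite k0 gt_eqF//.
Qed.

(** Composing [f] with the linear coordinate functionals identifies each component of the
    differential with a directional derivative. *)
Lemma diff_fstE (V : normedModType R) m n (f : V -> 'rV[R]_m * 'rV[R]_n) x v d :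
  differentiable f x -> row_derive x v (fun y => (f y).1) d -> ('d f x v).1 = d.
Proof.
move=> df Hd; apply/rowP => i; have [_ <-] := Hd i.
have [dc dE] := coord1_diff i (f x).
rewrite (deriveE (f := @coord1 R m n i \o f)); last exact: differentiable_comp.
by rewrite (diff_comp df dc) /= dE.
Qed.

Lemma diff_sndE (V : normedModType R) m n (f : V -> 'rV[R]_m * 'rV[R]_n) x v d :
  differentiable f x -> row_derive x v (fun y => (f y).2) d -> ('d f x v).2 = d.
Proof.
move=> df Hd; apply/rowP => i; have [_ <-] := Hd i.
have [dc dE] := coord2_diff i (f x).
rewrite (deriveE (f := @coord2 R m n i \o f)); last exact: differentiable_comp.
by rewrite (diff_comp df dc) /= dE.
Qed.

Lemma row_derive_fst m n (z v : 'rV[R]_m * 'rV[R]_n) :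
  row_derive z v (fun y => y.1) v.1.
Proof.
move=> i; have [dc dE] := coord1_diff i z.
apply: DeriveDef; first exact: (diff_derivable dc).
by rewrite (deriveE (f := @coord1 R m n i))// dE.
Qed.

Lemma row_derive_snd m n (z v : 'rV[R]_m * 'rV[R]_n) :
  row_derive z v (fun y => y.2) v.2.
Proof.
move=> i; have [dc dE] := coord2_diff i z.
apply: DeriveDef; first exact: (diff_derivable dc).
by rewrite (deriveE (f := @coord2 R m n i))// dE.
Qed.

Lemma diff_phi_plus (z u : V3 * V3) : Sigma_plus z ->
  let r := (S_plus z).1.1 in let s := (S_plus z).1.2 in let k := (S_plus z).2 in
  let dr := dS_r z.1 z.2 u.1 u.2 in let ds := dS_s z.1 z.2 u.1 u.2 in
  'd (@phi_plus R) z u =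
    (dR_x r s dr ds, dR_y r s dr ds k (dS_k z.1 z.2 u.1 u.2)).
Proof.
case: z => q p Sz r s k dr ds.
have dphi : differentiable (@phi_plus R) (q, p) := (phi_plus_smooth 1).1 _ Sz.
have [Hr Hs Hk] := row_derive_S_plus (x := (q, p)) (v := u) Sz
  (row_derive_fst _ _) (row_derive_snd _ _).
have k0 : (S_plus (q, p)).2 != 0 by case: (S_plus_T1H3 Sz) => _ ?; rewrite gt_eqF.
have [Hx Hy] := row_derive_R_plus Hr Hs Hk k0.
rewrite [LHS]surjective_pairing; congr pair.
- apply: (diff_fstE dphi); have -> // : (fun y : V3 * V3 => (phi_plus y).1) =
      (fun y => (R_plus (S_plus (y.1, y.2))).1) by apply/funext; case.
- apply: (diff_sndE dphi); have -> // : (fun y : V3 * V3 => (phi_plus y).2) =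
      (fun y => (R_plus (S_plus (y.1, y.2))).2) by apply/funext; case.
Qed.

Lemma phi_plus_symplectomorphism : symplectomorphism (@Sigma_plus R) (@omega_std R)
  (@N_plus R) (@omega_mink R) (@phi_plus R).
Proof.
split; [exact: open_Sigma_plus|exact: phi_plus_diffeomorphism|].
move=> [q p] Sz u v.
have := diff_phi_plus u Sz; have := diff_phi_plus v Sz.
have [T1 k0] := S_plus_T1H3 Sz.
have [ru su rsu] := mdot_dS Sz u.1 u.2; have [rv sv rsv] := mdot_dS Sz v.1 v.2.
have := omega_S Sz u.1 u.2 v.1 v.2.
move: T1 k0 ru su rsu rv sv rsv; case: (S_plus (q, p)) => [[r s] k] /=.
move=> T1 k0 ru su rsu rv sv rsv E -> ->.
by rewrite omega_R ?gt_eqF// E omega_stdE.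
Qed.

End symplectic.

(** * Kepler orbits *)

Section interval_ode.
Context {R : realType} (J : set R).
Hypothesis iJ : is_interval J.

Lemma is_interval_derive0 (f : R -> R) a b :
  (forall t, J t -> is_derive t 1 f 0) -> J a -> J b -> f a = f b.
Proof.
move=> f0; wlog ab : a b / a < b => [hw|] Ja Jb.
  by have [ab|ba|->//] := ltgtP a b; [exact: hw|apply: esym; exact: hw].
have Jt t : a <= t <= b -> J t by exact: iJ.
have [t||c _] := @MVT R f (fun=> 0) a b ab.
- by rewrite in_itv /= => /andP[a1 b1]; apply/f0/Jt; rewrite !ltW.
- apply: derivable_within_continuous => t; rewrite in_itv /= => /Jt/f0.
  by case.
- by rewrite mul0r => /eqP; rewrite subr_eq0 => /eqP.
Qed.

(** Rotating back gives constants: cosh(at) f - sinh(at) g and cosh(at) g - sinh(at) f have zero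
    derivative on the interval. *)
Lemma hyperbolic_ode (f g : R -> R) (a : R) : J 0 ->
  (forall t, J t -> is_derive t 1 f (a * g t)) ->
  (forall t, J t -> is_derive t 1 g (a * f t)) ->
  forall t, J t ->
  f t = cosh (a * t) * f 0 + sinh (a * t) * g 0 /\
  g t = sinh (a * t) * f 0 + cosh (a * t) * g 0.
Proof.
move=> J0 Hf Hg t Jt.
have Hlin (u : R) : is_derive u (1 : R) (fun u => a * u) a.
  by apply: is_derive_eq; rewrite [LHS]mulr1.
have HC u := is_derive_chain (Hlin u) (is_derive_cosh (a * u)).
have HS u := is_derive_chain (Hlin u) (is_derive_sinh (a * u)).
have E1 : cosh (a * t) * f t - sinh (a * t) * g t = f 0.
  have h u : J u -> is_derive u 1
      ((fun u => cosh (a * u) * f u) - (fun u => sinh (a * u) * g u)) 0.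
    move=> Ju.
    have := is_deriveB (is_derive_mul (HC u) (Hf u Ju)) (is_derive_mul (HS u) (Hg u Ju)).
    by set d := (X in is_derive _ _ _ X); suff -> : d = 0 by []; rewrite /d; ring.
  rewrite [LHS](is_interval_derive0 h Jt J0) !fctE.
  by rewrite mulr0 cosh0 sinh0 mul1r mul0r subr0.
have E2 : cosh (a * t) * g t - sinh (a * t) * f t = g 0.
  have h u : J u -> is_derive u 1
      ((fun u => cosh (a * u) * g u) - (fun u => sinh (a * u) * f u)) 0.
    move=> Ju.
    have := is_deriveB (is_derive_mul (HC u) (Hg u Ju)) (is_derive_mul (HS u) (Hf u Ju)).
    by set d := (X in is_derive _ _ _ X); suff -> : d = 0 by []; rewrite /d; ring.
  rewrite [LHS](is_interval_derive0 h Jt J0) !fctE.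
  by rewrite mulr0 cosh0 sinh0 mul1r mul0r subr0.
have E := cosh2_sinh2 (a * t).
rewrite -E1 -E2; split.
- by rewrite -[LHS]mul1r -E; ring.
- by rewrite -[LHS]mul1r -E; ring.
Qed.

End interval_ode.

(** * The Kepler vector field in the new coordinates *)

Section kepler_flow.
Context {R : realType}.
Local Notation V3 := 'rV[R]_3.
Local Notation V4 := 'rV[R]_4.

Section flow.
Variables (q p : V3).
Hypothesis Sqp : Sigma_plus (q, p).
Let r := (S_plus (q, p)).1.1.
Let s := (S_plus (q, p)).1.2.
Let k := (S_plus (q, p)).2.
Let dp := - enorm q ^- 3 *: q.

(** The direction (p, dp) is the Kepler vector field at (q, p), so these are the velocities of r, s
    and k along an orbit. *)
Lemma dS_flow : [/\ dS_r q p p dp = - (k / enorm q) *: s,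
  dS_s q p p dp = - (k / enorm q) *: r & dS_k q p p dp = 0].
Proof.
have [n0 k0 pp] := sqr_energy Sqp.
rewrite /r /s /k /S_plus /dS_r /dS_s /dS_k /dp /=.
set n := enorm q in n0 pp *; set K := Num.sqrt _ in k0 pp *.
have k'0 : (dot p (- n ^- 3 *: q) + dot q p / n / n ^+ 2) / K = 0.
  by rewrite dotZr (dotC p q); field; lra.
split; last exact: k'0.
- rewrite k'0; apply: mvec_eqP.
    by rewrite mvec0 mxE mvec0 dotZr (dotC p q) pp; field; lra.
  by rewrite spatialZ !spatial_mvec; apply/rowP => i; rewrite !mxE; field; lra.
- rewrite k'0; apply: mvec_eqP.
    by rewrite mvec0 mxE mvec0 dotZr -(sqr_enorm q) -/n pp; field; lra.
  rewrite spatialZ !spatial_mvec dotZr -(sqr_enorm q) -/n pp.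
  by apply/rowP => i; rewrite !mxE; field; lra.
Qed.

(** The motion of r and s contributes the rate -k/|q|, the varying angle, with s_0' = -(k/|q|) r_0,
    the rate (k/|q|) r_0. The sum (k/|q|) (r_0 - 1) is the constant k^3, because r_0 - 1 = k^2
    |q|. *)
Lemma dR_flow : let x := (phi_plus (q, p)).1 in let y := (phi_plus (q, p)).2 in
  dR_x r s (dS_r q p p dp) (dS_s q p p dp) = k ^+ 3 *: (k *: y) /\
  k *: dR_y r s (dS_r q p p dp) (dS_s q p p dp) k (dS_k q p p dp) = k ^+ 3 *: x.
Proof.
have [-> -> ->] := dS_flow.
have [n0 k0 pp] : [/\ 0 < enorm q, 0 < k & dot p p = k ^+ 2 + 2 / enorm q].
  exact: sqr_energy.
have r0 : r 0 0 = k ^+ 2 * enorm q + 1.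
  by rewrite /r mvec0 pp; field; lra.
rewrite (_ : phi_plus (q, p) = R_plus ((r, s), k))//.
rewrite /R_plus /dR_x /dR_y mul0r scale0r subr0 /=.
have -> : (- (k / enorm q) *: r) 0 0 = - (k / enorm q) * r 0 0 by rewrite mxE.
rewrite r0; move: k0; generalize r s k => r' s' k' k0.
by split; apply/rowP => i; rewrite !mxE; field; lra.
Qed.

End flow.

End kepler_flow.

Section vector_derive.
Context {R : realType} {V : normedModType R} (x v : V).

Lemma row_deriveP n (f : V -> 'rV[R]_n) df :
  row_derive x v f df <-> is_derive x v f df.
Proof.
split=> [H|[d <-] i].
  have d : derivable f x v.
    by apply/derivable_mxP => i j; rewrite (ord1 i); case: (H j).
  split=> //; rewrite derive_mx//; apply/rowP => j; rewrite mxE.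
  by case: (H j).
split; first by have /derivable_mxP := d; exact.
by rewrite derive_mx// mxE.
Qed.

End vector_derive.

(** * Geodesics of hyperbolic space *)

Section geodesic.
Context {R : realType}.

Lemma is_derive_hrot (w : 'rV[R]_4 * 'rV[R]_4) (t : R) :
  is_derive t (1 : R) (fun u => (hrot u w).1) (hrot t w).2 /\
  is_derive t (1 : R) (fun u => (hrot u w).2) (hrot t w).1.
Proof.
have cst_row (c : 'rV[R]_4) : row_derive t (1 : R) (fun=> c) 0.
  by move=> i; rewrite mxE; exact: is_derive_cst.
have HC := is_derive_cosh t; have HS := is_derive_sinh t.
split; apply/row_deriveP.
- have := row_deriveD (row_deriveZ HC (cst_row w.1)) (row_deriveZ HS (cst_row w.2)).
  set d := _ + _; suff -> : d = (hrot t w).2 by [].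
  by rewrite /d !scaler0 !add0r.
- have := row_deriveD (row_deriveZ HS (cst_row w.1)) (row_deriveZ HC (cst_row w.2)).
  set d := _ + _; suff -> : d = (hrot t w).1 by [].
  by rewrite /d !scaler0 !add0r.
Qed.

Lemma derive1_hrot1 (w : 'rV[R]_4 * 'rV[R]_4) :
  (fun u : R => (hrot u w).1)^`()%classic = (fun u => (hrot u w).2).
Proof.
by apply/funext => t; rewrite derive1E; have [[_ ->] _] := is_derive_hrot w t.
Qed.

Lemma derive1_hrot2 (w : 'rV[R]_4 * 'rV[R]_4) :
  (fun u : R => (hrot u w).2)^`()%classic = (fun u => (hrot u w).1).
Proof.
by apply/funext => t; rewrite derive1E; have [_ [_ ->]] := is_derive_hrot w t.
Qed.

(** The curve equals its own second derivative, and the position vector is normal to the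
    hyperboloid. *)
Lemma hrot_geodesic (w : 'rV[R]_4 * 'rV[R]_4) : T1H3 w ->
  geodesic_H3 (fun t => (hrot t w).1).
Proof.
move=> T1; split=> t.
- by have [[]] := T1H3_hrot t T1.
- by have [[]] := is_derive_hrot w t.
- by rewrite derive1_hrot1; have [_ []] := is_derive_hrot w t.
- by move=> v; rewrite /derive1n /= derive1_hrot1 derive1_hrot2.
Qed.

End geodesic.

(** * Orbits with periapsis at time zero *)

Section orbit.
Context {R : realType}.
Variables (J : set R) (c : R -> 'rV[R]_3 * 'rV[R]_3).
Hypotheses (oJ : open J) (iJ : is_interval J) (J0 : J 0) (kc : kepler_orbit J c).
Hypothesis H0 : 0 < energy (c 0).

Let row_c t : J t -> [/\ (c t).1 != 0, row_derive t 1 (fun u => (c u).1) (c t).2 &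
  row_derive t 1 (fun u => (c u).2) (- enorm (c t).1 ^- 3 *: (c t).1)].
Proof. by move=> /kc[q0 /row_deriveP Hq /row_deriveP Hp]. Qed.

Lemma energy_conserved t : J t -> energy (c t) = energy (c 0).
Proof.
move=> Jt; suff h u : J u -> is_derive u (1 : R) (fun t => energy (c t)) 0.
  exact: (is_interval_derive0 iJ h Jt J0).
move=> Ju; have [q0 Hq Hp] := row_c Ju.
have := is_derive_energy (Q := fun u => (c u).1) (P := fun u => (c u).2) q0 Hq Hp.
have -> : (fun y => energy ((c y).1, (c y).2)) = (fun t => energy (c t)).
  by apply/funext => y; rewrite -surjective_pairing.
set d := _ + _; suff -> : d = 0 by [].
have n0 : 0 < enorm (c u).1 by rewrite enorm_gt0.
by rewrite /d dotZr (dotC (c u).2); field; lra.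
Qed.

Lemma orbit_Sigma t : J t -> Sigma_plus ((c t).1, (c t).2).
Proof.
by move=> Jt; split; [case: (kc Jt)|rewrite -surjective_pairing energy_conserved].
Qed.

Let k := Num.sqrt (2 * energy (c 0)).
Let k_gt0 : 0 < k. Proof. by rewrite sqrtr_gt0 mulr_gt0. Qed.

Lemma S_plus2E t : J t -> (S_plus (c t)).2 = k.
Proof. by move=> Jt; rewrite /S_plus /= energy_conserved. Qed.

(** By [dR_flow], each coordinate of the pair (x, k y) solves the linear system of [hyperbolic_ode]
    with rate k^3. *)
Lemma phi_plus_orbit t : J t ->
  (phi_plus (c t)).1 = (hrot (k ^+ 3 * t) ((phi_plus (c 0)).1, k *: (phi_plus (c 0)).2)).1 /\
  k *: (phi_plus (c t)).2 =
    (hrot (k ^+ 3 * t) ((phi_plus (c 0)).1, k *: (phi_plus (c 0)).2)).2.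
Proof.
move=> Jt.
pose x u := (phi_plus (c u)).1; pose y u := (phi_plus (c u)).2.
have Hxy u : J u -> row_derive u (1 : R) x (k ^+ 3 *: (k *: y u)) /\
    row_derive u (1 : R) (fun u => k *: y u) (k ^+ 3 *: x u).
  move=> Ju; have [q0 Hq Hp] := row_c Ju; have Su := orbit_Sigma Ju.
  have [Hr Hs Hk] := row_derive_S_plus (Q := fun u => (c u).1) (P := fun u => (c u).2) Su Hq Hp.
  have kE : (S_plus ((c u).1, (c u).2)).2 = k.
    by rewrite -surjective_pairing S_plus2E.
  have k0 : (S_plus ((c u).1, (c u).2)).2 != 0 by rewrite kE gt_eqF.
  have [Hx Hy] := row_derive_R_plus Hr Hs Hk k0.
  have [Ex Ey] := dR_flow Su; rewrite kE in Ex Ey Hy.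
  have xE : x = fun y => (R_plus (S_plus ((c y).1, (c y).2))).1.
    by apply/funext => z; rewrite -surjective_pairing.
  have yE : y = fun y => (R_plus (S_plus ((c y).1, (c y).2))).2.
    by apply/funext => z; rewrite -surjective_pairing.
  split.
    rewrite Ex in Hx; rewrite /y [c u]surjective_pairing; rewrite xE; exact: Hx.
  have := row_deriveZ (is_derive_cst k u (1 : R)) Hy.
  rewrite scale0r addr0 [cst k u]/= Ey.
  by rewrite /x [c u in X in _ -> X]surjective_pairing yE.
have coord i := hyperbolic_ode (J := J) (f := fun u => x u 0 i)
  (g := fun u => (k *: y u) 0 i) (a := k ^+ 3) iJ J0.
have {}coord i : x t 0 i = cosh (k ^+ 3 * t) * x 0 0 i + sinh (k ^+ 3 * t) * (k *: y 0) 0 i /\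
  (k *: y t) 0 i = sinh (k ^+ 3 * t) * x 0 0 i + cosh (k ^+ 3 * t) * (k *: y 0) 0 i.
  apply: coord => // u Ju; have [Hx Hy] := Hxy u Ju.
  - by have := Hx i; rewrite mxE.
  - by have := Hy i; rewrite [X in is_derive _ _ _ X]mxE.
split; apply/rowP => i; rewrite [RHS]mxE.
- by rewrite (coord i).1; congr (_ + _); rewrite [RHS]mxE.
- by rewrite (coord i).2; congr (_ + _); rewrite [RHS]mxE.
Qed.

(** As [J] is open, 0 is an interior minimum of |q|, whose derivative is <q, p>/|q|. *)
Lemma periapsis_dot0 : periapsis_at_0 J c -> dot (c 0).1 (c 0).2 = 0.
Proof.
move=> per; have /nbhs_ballP[d /= d0 Hd] : nbhs 0 J by exact: open_nbhs_nbhs.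
have Jt t : t \in `](- d), d[ -> J t.
  move=> td; apply: Hd; rewrite /ball /= sub0r normrN.
  by rewrite ltr_norml; rewrite in_itv in td.
have Hn t : J t -> is_derive t (1 : R) (fun u => enorm (c u).1)
    (dot (c t).1 (c t).2 / enorm (c t).1).
  by move=> /row_c[q0 Hq _]; exact: (is_derive_enorm (f := fun u => (c u).1)).
have z : (0 : R) \in `](- d), d[ by rewrite in_itv /= oppr_lt0 d0.
have [|||_] := @derive1_at_min R (fun u => enorm (c u).1) (- d) d 0 _ _ z.
- lra.
- by move=> t /Jt/Hn[].
- by move=> t /Jt; exact: per.
have [_ ->] := Hn 0 J0; have [q0 _ _] := row_c J0.
by move=> /eqP; rewrite mulf_eq0 invr_eq0 (gt_eqF (_ : 0 < enorm _)) ?enorm_gt0// orbF => /eqP.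
Qed.

Variables psi M : R -> R.
Hypothesis e1 : 1 < eccentricity (c 0).
Hypothesis per : periapsis_at_0 J c.
Hypothesis anom : hyperbolic_anomalies J c psi M.

Let r t := (S_plus (c t)).1.1.
Let s t := (S_plus (c t)).1.2.

Lemma s0_periapsis : s 0 0 0 = 0.
Proof. by rewrite /s mvec0 periapsis_dot0// mulr0 oppr0. Qed.

(** The anomaly relation at time 0 reads |q| = (e - 1)/k^2, and r_0 = k^2 |q| + 1. *)
Lemma r0_periapsis : r 0 0 0 = eccentricity (c 0).
Proof.
have [_ p0 /(_ 0 J0) nE _ _] := anom.
rewrite p0 cosh0 mulr1 in nE.
have [n0 k0 pp] := sqr_energy (orbit_Sigma J0).
rewrite -surjective_pairing -/k in pp.
have kk : 2 * energy (c 0) = k ^+ 2 by rewrite sqr_sqrtr// mulr_ge0// ltW.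
rewrite /r mvec0 pp nE kk; move: k_gt0 e1.
by generalize k (eccentricity (c 0)) => k' e' k'0 e'1; field; lra.
Qed.

(** At periapsis s_0 = 0, so R_+ rotates by angle 0. *)
Lemma phi_plus_periapsis : ((phi_plus (c 0)).1, k *: (phi_plus (c 0)).2) = (r 0, s 0).
Proof.
have -> : phi_plus (c 0) = R_plus ((r 0, s 0), k).
  by rewrite /phi_plus [S_plus (c 0)]surjective_pairing S_plus2E// -surjective_pairing.
by rewrite R_plus_hrot ?gt_eqF// s0_periapsis oppr0 hrot0.
Qed.

Lemma orbit_hrot t : J t ->
  (phi_plus (c t)).1 = (hrot (k ^+ 3 * t) (r 0, s 0)).1 /\
  k *: (phi_plus (c t)).2 = (hrot (k ^+ 3 * t) (r 0, s 0)).2.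
Proof. by rewrite -phi_plus_periapsis; exact: phi_plus_orbit. Qed.

(** The semi-axis is k^-2, and its power -3/2 is k^3. *)
Lemma mean_anomalyE t : J t -> M t = k ^+ 3 * t.
Proof.
have [_ _ _ _ ME] := anom => /ME ->; congr (_ * _).
have -> : (2 * energy (c 0))^-1 = k `^ (- 2%:R).
  by rewrite powR_invn ?ltW// sqr_sqrtr// mulr_ge0// ltW.
rewrite -powRrM (_ : _ * _ = 3%:R); last by field.
by rewrite powR_mulrn// ltW.
Qed.

Lemma hyperbolic_anomalyE t : J t -> - psi t - s t 0 0 = M t.
Proof.
move=> Jt; have [_ _ _ /(_ t Jt) Mpsi _] := anom.
have [Ex Ey] := orbit_hrot Jt.
(* Undoing R_+ rotates (x, k y) by s_0(t), and (x, k y) is itself the initial pair rotated by k^3 t;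
   the angles add. *)
have sE : s t = (hrot (s t 0 0 + k ^+ 3 * t) (r 0, s 0)).2.
  rewrite hrotD [hrot (k ^+ 3 * t) _]surjective_pairing -Ex -Ey.
  have -> : phi_plus (c t) = R_plus ((r t, s t), k).
    by rewrite /phi_plus [S_plus (c t)]surjective_pairing S_plus2E// -surjective_pairing.
  by rewrite R_plus_hrot ?gt_eqF// -hrotD subrr hrot0.
set th := s t 0 0 + _ in sE.
have s0E : s t 0 0 = eccentricity (c 0) * sinh th.
  by rewrite [in LHS]sE hrot2E /= s0_periapsis r0_periapsis /kepler_fun; ring.
have e0 : 0 < eccentricity (c 0) by exact: lt_trans e1.
have ee : 1 <= eccentricity (c 0) ^+ 2 - 0 ^+ 2.
  by rewrite expr0n subr0 exprn_ege1 ?ltW.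
(* Both sides solve e sinh u - u = M(t), the Kepler equation with coefficients e and 0, whose left
   side is injective. *)
have psiE : psi t = - th.
  apply: (kepler_fun_inj e0 ee); rewrite /kepler_fun !mul0r !addr0 -Mpsi.
  by rewrite mean_anomalyE// sinhN mulrN -s0E /th; ring.
by rewrite mean_anomalyE// psiE /th; ring.
Qed.

End orbit.

Theorem theorem5p13 (R : realType) :
  symplectomorphism (@Sigma_plus R) (@omega_std R) (@N_plus R) (@omega_mink R)
    (@phi_plus R)
  /\
  (forall (J : set R) (c : R -> 'rV[R]_3 * 'rV[R]_3) (psi M : R -> R),
     open J -> is_interval J -> J 0 ->
     kepler_orbit J c ->
     0 < energy (c 0) ->
     1 < eccentricity (c 0) ->
     periapsis_at_0 J c ->
     hyperbolic_anomalies J c psi M ->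
     let r := fun t => (S_plus (c t)).1.1 in
     let s := fun t => (S_plus (c t)).1.2 in
     let s0 := fun t => s t 0 0 in
     let x := fun t => (phi_plus (c t)).1 in
     let y := fun t => (phi_plus (c t)).2 in
     let k := Num.sqrt (2 * energy (c 0)) in
     (forall t, J t ->
        [/\ x t = cosh (- psi t - s0 t) *: r 0 + sinh (- psi t - s0 t) *: s 0,
            y t = k^-1 *: (sinh (- psi t - s0 t) *: r 0
                           + cosh (- psi t - s0 t) *: s 0) &
            - psi t - s0 t = M t])
     /\
     exists g : R -> 'rV[R]_4,
       [/\ geodesic_H3 g, g 0 = r 0, g^`()%classic 0 = s 0 &
           forall t, J t -> x t = g (M t) /\ y t = k^-1 *: g^`()%classic (M t)]).
Proof.
split; first exact: phi_plus_symplectomorphism.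
move=> J c psi M oJ iJ J0 kc H0 e1 per anom r s s0 x y k.
have k0 : k != 0 by rewrite gt_eqF// sqrtr_gt0 mulr_gt0.
have xyE t : J t -> x t = (hrot (M t) (r 0, s 0)).1 /\
    y t = k^-1 *: (hrot (M t) (r 0, s 0)).2.
  move=> Jt; rewrite (mean_anomalyE H0 anom Jt).
  have [Ex Ey] := orbit_hrot oJ iJ J0 kc H0 per Jt.
  by split=> //; rewrite -Ey scalerA mulVf// scale1r.
have ME t : J t -> - psi t - s0 t = M t.
  exact: (hyperbolic_anomalyE oJ iJ J0 kc H0 e1 per anom).
split=> [t Jt|]; first by rewrite ME//; have [-> ->] := xyE t Jt.
(* The witness is the unit-speed geodesic through r(0) with velocity s(0). *)
exists (fun t => (hrot t (r 0, s 0)).1); rewrite derive1_hrot1.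
have [T1 _] : T1H3 (S_plus (c 0)).1 /\ 0 < (S_plus (c 0)).2.
  by apply: S_plus_T1H3; split=> //; case: (kc 0 J0).
split; [|by rewrite hrot0|by rewrite hrot0|exact: xyE].
by apply: hrot_geodesic; rewrite -surjective_pairing.
Qed.
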